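(* For every graph $H$ and every constant $\delta>0$ there is a constant $c$ (depending only on $H$ and $\delta$) such that the online exploration algorithm $\textsc{Blocking}_\delta$ is $c$-competitive on the class of $H$-minor-free graphs, i.e. $\textsc{Blocking}_\delta(G,v)\le c\cdot \textsc{Opt}(G)$ for every $H$-minor-free graph $G$ (connected, undirected, with non-negative edge weights) and every start vertex $v$ of $G$.
   Context: Online graph exploration: an agent starts at a vertex $v$ of an initially unknown connected undirected graph $G=(V,E)$ with edge weights $w\colon E\to\mathbb{R}_{\ge 0}$. When the agent visits a vertex it learns the identifiers of all adjacent vertices and the weights of the incident edges. Traversing an edge costs its weight. The agent must visit all vertices and return to $v$. $\textsc{Alg}(G,v)$ denotes the total cost of algorithm $\textsc{Alg}$, and $\textsc{Opt}(G)$ the length of a shortest closed walk visiting all vertices (a shortest TSP tour). An algorithm is $\rho$-competitive on a class of graphs if $\textsc{Alg}(G,v)\le\rho\cdot\textsc{Opt}(G)$ for every graph $G$ of the class and every vertex $v$ of $G$; when the algorithm has free choices, this must hold for every way of making them. Algorithm $\textsc{Blocking}_\delta$ ($\delta>0$). A vertex is explored once visited. A boundary edge $e=(u,x)$ is an edge with $u$ explored and $x$ unexplored. For vertices $x,y$, $d(x,y)$ is the current length of a shortest path from $x$ to $y$ all of whose internal vertices are explored. A boundary edge $e=(u,x)$ is $\delta$-blocked if there is another boundary edge $e'=(u',x')$ with $w(e')<w(e)$ and $d(u,x')\le(1+\delta)w(e)$. The recursive procedure $\textsc{Blocking}_\delta(v)$ (with $v$ the agent's current position) is: while there is a boundary edge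 $e=(y,x)$ that is not $\delta$-blocked and such that either $y=v$ or $e$ was at some earlier time $\delta$-blocked by a boundary edge whose unexplored endpoint was $v$, do: traverse a shortest internally explored path from $v$ to $y$; traverse $e$; call $\textsc{Blocking}_\delta(x)$; traverse a shortest internally explored path from $x$ back to $v$. The algorithm is the call $\textsc{Blocking}_\delta(s)$ at the start vertex $s$; if several edges qualify, any of them may be chosen. *)

(* Defs.v *)
From mathcomp Require Import all_boot all_order all_algebra.
From mathcomp Require Import reals.

Set Implicit Arguments.
Unset Strict Implicit.
Unset Printing Implicit Defensive.

Import Order.TTheory GRing.Theory Num.Theory.
Local Open Scope ring_scope.

Record sgraph := SGraph {
  vertex :> finType;
  adj : rel vertex;
  adj_sym : symmetric adj;
  adj_irrefl : irreflexive adj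
}.
Arguments adj {s}.

Definition connected_in (G : sgraph) (A : {set G}) : Prop :=
  A != set0 /\
  {in A &, forall x y,
     connect [rel a b | [&& a \in A, b \in A & adj a b]] x y}.

Definition connected_graph (G : sgraph) : Prop := connected_in [set: G].

(* phi assigns to each vertex of H its branch set in G. *)
Definition minor (H G : sgraph) : Prop :=
  exists phi : H -> {set G},
    [/\ forall a, connected_in (phi a),
        forall a b, a != b -> [disjoint phi a & phi b]
      & forall a b, adj a b -> exists x y, [/\ x \in phi a, y \in phi b & adj x y]].

Definition minor_free (H G : sgraph) : Prop := ~ minor H G.

Section Exploration.
Variables (R : realType) (G : sgraph).

(* The values of w outside the edges of G are irrelevant. *)
Definition edge_weighting (w : G -> G -> R) : Prop :=
  forall x y, adj x y -> w x y = w y x /\ 0 <= w x y.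

Variable w : G -> G -> R.

(* A walk is given, as for [path], by its first vertex x and the sequence p of
   the vertices that follow it. *)
Fixpoint walk_length (x : G) (p : seq G) : R :=
  if p is y :: p' then w x y + walk_length y p' else 0.

Definition tour (x : G) (p : seq G) : Prop :=
  [/\ path adj x p, last x p = x & forall z, z \in x :: p].

Definition opt : R :=
  inf (fun r : R => exists x p, tour x p /\ r = walk_length x p).

(* In what follows S is the set of explored vertices. *)
Definition internally_explored_path (S : {set G}) (x y : G) (p : seq G) : Prop :=
  [/\ path adj x p, last x p = y, uniq (x :: p)
    & {in x :: p, forall z, z != x -> z != y -> z \in S}].

Definition shortest_path (S : {set G}) (x y : G) (p : seq G) : Prop :=
  internally_explored_path S x y p /\
  forall q, internally_explored_path S x y q ->
    walk_length x p <= walk_length x q.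

(* d(x, y) <= r; d(x, y) is infinite if there is no path. *)
Definition dist_le (S : {set G}) (x y : G) (r : R) : Prop :=
  exists2 p, shortest_path S x y p & walk_length x p <= r.

Definition boundary (S : {set G}) (e : G * G) : Prop :=
  [/\ adj e.1 e.2, e.1 \in S & e.2 \notin S].

Variable delta : R.

Definition blocked_by (S : {set G}) (e e' : G * G) : Prop :=
  [/\ boundary S e, boundary S e', w e'.1 e'.2 < w e.1 e.2
    & dist_le S e.1 e'.2 ((1 + delta) * w e.1 e.2)].

Definition blocked (S : {set G}) (e : G * G) : Prop :=
  exists e', blocked_by S e e'.

(* A history h lists the explored vertices in the order of their first visits.
   The set of explored vertices determines which edges are boundary and which
   are blocked, so the earlier points in time are the proper prefixes of h. *)
Definition explored (h : seq G) : {set G} := [set z in h].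

Definition eligible (h : seq G) (v : G) (e : G * G) : Prop :=
  [/\ boundary (explored h) e,
      ~ blocked (explored h) e
    & e.1 = v \/
      exists k u, (k < size h)%N /\ blocked_by (explored (take k h)) e (u, v)].

(* [blocking_call h v h' t]: the call at v, made with history h, can return
   with history h', the agent having walked from v along t (back to v). *)
Inductive blocking_call : seq G -> G -> seq G -> seq G -> Prop :=
| BlockingStop h v :
    (forall e, ~ eligible h v e) ->
    blocking_call h v h [::]
| BlockingStep h v y x p h1 t1 q h2 t2 :
    eligible h v (y, x) ->
    shortest_path (explored h) v y p ->
    blocking_call (rcons h x) x h1 t1 ->
    shortest_path (explored h1) x v q ->
    blocking_call h1 v h2 t2 ->
    blocking_call h v h2 (p ++ x :: t1 ++ q ++ t2).

Definition blocking_run (s : G) (t : seq G) : Prop :=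
  exists h, blocking_call [:: s] s h t.

End Exploration.

(* An algorithm is given by its possible runs: the walks, from the start
   vertex, that result from the different ways of making the free choices. *)
Definition algorithm (R : realType) : Type :=
  forall G : sgraph, (G -> G -> R) -> G -> seq G -> Prop.

Definition blocking (R : realType) (delta : R) : algorithm R :=
  fun G w s t => blocking_run w delta s t.

Definition competitive (R : realType) (alg : algorithm R)
    (C : sgraph -> Prop) (c : R) : Prop :=
  forall (G : sgraph) (w : G -> G -> R) (s : G) (t : seq G),
    connected_graph G -> edge_weighting w -> C G ->
    alg G w s t -> walk_length w s t <= c * opt w.

(* Main.v *)
Require Import Defs.
From mathcomp Require Import all_boot all_order all_algebra.
From mathcomp Require Import reals boolp.
From mathcomp Require Import zify ring lra.

Set Implicit Arguments.
Unset Strict Implicit.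
Unset Printing Implicit Defensive.

Import Order.TTheory GRing.Theory Num.Theory.

(* Charge the walk to the set B of edges along which vertices are first
   reached: every detour is bounded by (1 + delta) w(e) for the edge e it leads
   to, so the walk costs O(w(B)).  The edges of B behave like those of a greedy
   spanner: when f is charged at explored set S, every walk between the ends of
   f whose edges are lighter than f or lie inside S is longer than
   (1 + delta) w(f).

   To bound w(B) by a multiple of a tour, take a spanning tree T inside the
   tour and treat the edges of B of weight about K u for u = u_0, E u_0,
   E^2 u_0, ..., maintaining a tree, the core, that comes within distance u of
   every vertex.  At scale u cut the core into clusters of radius O(u).  The
   edges of B of this scale join distinct clusters, no two of them the same
   pair, so they form a minor of G, and by Mader's theorem there are O(1) of
   them per cluster that they touch.  A leaf of the tree of clusters can be
   dropped, which saves u; if there are few leaves then most clusters lie on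
   long unbranched chains, and there a piece of the core can be replaced by an
   edge of B that is shorter by at least u.  In both cases the weight of the
   core decreases by a constant times u times the number of edges of B of this
   scale, up to u for every core edge longer than u.  Such edges belong to T
   and their contributions over all scales form geometric series; the
   decrements telescope. *)

(** * Dense graphs have clique minors *)

(** A fixed tree T would not do: at scale [u] it may have about w(T)/u clusters, which allows edges
    of [B] of total weight O(w(T)) at every scale, and the number of scales is unbounded. The edges
    of a scale must therefore be paid by something that is used up, the weight of the core. The core
    can shrink because it need not span: whatever is small at the current scale may be left hanging
    from it. One scale multiplies the covering radius by at most 4 + 2(K + 3), and [E] is at least
    that. An edge of [B] taken into the core weighs at most K u, hence at most the next scale, which
    is why an edge too long for its scale can only stem from T. The parameter [K] is about 32/delta.
    The slack delta w(e) in the stretch has to exceed every detour through clusters, a fixed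
    multiple of [u], while w(e) lies between K u/2 and K u. Such a class spans only a factor 2, much
    less than [E]; so the dyadic classes are dealt out to several sequences of scales, and each
    sequence starts anew from T. *)

Section Density.
Variable G : sgraph.
Implicit Types (A B C X Y : {set G}) (P : {set {set G}}).

Definition touch A B : bool := [exists x in A, exists y in B, adj x y].

Lemma touchP A B :
  reflect (exists x y, [/\ x \in A, y \in B & adj x y]) (touch A B).
Proof.
apply: (iffP exists_inP) => [[x xA /exists_inP[y yB xy]]|[x [y [xA yB xy]]]].
  by exists x, y.
by exists x => //; apply/exists_inP; exists y.
Qed.

Lemma touchC A B : touch A B = touch B A.
Proof.
by apply/touchP/touchP => -[x [y [xA yB xy]]]; exists y, x; rewrite adj_sym.
Qed.

Lemma touchS A A' B B' :
  A \subset A' -> B \subset B' -> touch A B -> touch A' B'.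
Proof.
move=> /subsetP sA /subsetP sB /touchP[x [y [xA yB xy]]].
by apply/touchP; exists x, y; split=> //; [apply: sA|apply: sB].
Qed.

Lemma touchUl A B C : touch (A :|: B) C = touch A C || touch B C.
Proof.
apply/touchP/orP => [[x [y [/setUP[xA|xB] yC xy]]]|[]/touchP[x [y [xA yC xy]]]].
- by left; apply/touchP; exists x, y.
- by right; apply/touchP; exists x, y.
- by exists x, y; rewrite inE xA.
- by exists x, y; rewrite inE xA orbT.
Qed.

Lemma connected_inU A B :
  connected_in A -> connected_in B -> touch A B -> connected_in (A :|: B).
Proof.
move=> [A0 cA] [B0 cB] /touchP[a [b [aA bB ab]]]; split.
  by apply/set0Pn; exists a; rewrite inE aA.
pose r := [rel x y | [&& x \in A :|: B, y \in A :|: B & adj x y]].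
have sA x y : x \in A -> y \in A -> connect r x y.
  move=> xA yA; apply: connect_sub (cA x y xA yA) => u v /= /and3P[uA vA uv].
  by apply: connect1; rewrite /= !inE uA vA.
have sB x y : x \in B -> y \in B -> connect r x y.
  move=> xA yA; apply: connect_sub (cB x y xA yA) => u v /= /and3P[uA vA uv].
  by apply: connect1; rewrite /= !inE uA vA !orbT.
have rab : connect r a b by apply: connect1; rewrite /= !inE aA bB orbT.
have rba : connect r b a by apply: connect1; rewrite /= !inE aA bB orbT adj_sym.
move=> x y /setUP[xA|xB] /setUP[yA|yB]; [exact: sA| | |exact: sB].
- exact: connect_trans (sA _ _ xA aA) (connect_trans rab (sB _ _ bB yB)).
- exact: connect_trans (sB _ _ xB bB) (connect_trans rba (sA _ _ aA yA)).
Qed.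

Definition branch_family P :=
  {in P, forall A, connected_in A} /\
  {in P &, forall A B, A != B -> [disjoint A & B]}.

Definition nb P A := [set B in P | (B != A) && touch A B].

Definition npairs P := \sum_(A in P) #|nb P A|.

(** The last clause serves the induction on [h]: a set that touches every member of [P] touches
    every [K i], so it can be added to the clique. *)
Definition clique_over h P := exists K : 'I_h -> {set G},
  [/\ forall i, connected_in (K i),
      forall i j, i != j -> [disjoint K i & K j] && touch (K i) (K j)
    & forall i, K i \subset cover P /\ exists2 A, A \in P & A \subset K i].

Lemma branch_familyS P P' :
  P' \subset P -> branch_family P -> branch_family P'.
Proof.
move=> /subsetP sP [cP dP]; split=> [A /sP/cP //|A B /sP AP /sP BP].
exact: dP.
Qed.

(** * Contraction of two touching branch sets *)

Section Contract.
Variables (P : {set {set G}}) (A B : {set G}).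
Hypotheses (fP : branch_family P) (AP : A \in P) (BP : B \in P).
Hypotheses (AB : A != B) (tAB : touch A B).

Let P0 := P :\ A :\ B.
Definition contract := (A :|: B) |: (P :\ A :\ B).

Lemma contract_disj X : X \in P0 -> [disjoint X & A :|: B].
Proof.
rewrite !inE => /and3P[XB XA XP]; have [_ dP] := fP.
rewrite -setI_eq0 setIUr setU_eq0 !setI_eq0.
by rewrite !dP.
Qed.

Lemma contract_notin : A :|: B \notin P0.
Proof.
apply/negP => /contract_disj; rewrite -setI_eq0 setIid => /eqP AB0.
have [[/set0Pn[x xA] _] _] := (fP.1 A AP, tt).
by have := in_set0 x; rewrite -AB0 inE xA.
Qed.

Lemma contract_family : branch_family contract.
Proof.
have sP0 X : X \in P0 -> X \in P by rewrite !inE => /and3P[].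
split=> [X /setU1P[->|/sP0]|X Y /setU1P[->|X0] /setU1P[->|Y0] XY].
- by apply: connected_inU => //; apply: fP.1.
- exact: fP.1.
- by rewrite eqxx in XY.
- by rewrite disjoint_sym; apply: contract_disj.
- exact: contract_disj.
- by apply: fP.2 => //; apply: sP0.
Qed.

Lemma card_P0 : #|P| = #|P0|.+2.
Proof.
rewrite (cardsD1 A) AP (cardsD1 B (P :\ A)) !inE BP eq_sym AB /=.
by rewrite add1n.
Qed.

Lemma card_contract : #|P| = #|contract|.+1.
Proof. by rewrite /contract cardsU1 contract_notin card_P0. Qed.

(** Pairs are ordered. The pair of [A] and [B] disappears in both orders, and for each common
    neighbour two pairs merge into one, again in both orders. *)
Lemma npairs_contract :
  npairs P <= npairs contract + (#|nb P A :&: nb P B|.+1).*2.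
Proof.
have eqP0 F : \sum_(X in P) F X = F A + F B + \sum_(X in P0) F X :> nat.
  rewrite (big_setD1 A) //= (big_setD1 B) ?addnA //=.
  by rewrite !inE BP eq_sym AB.
rewrite /npairs eqP0 big_setU1 ?contract_notin //=.
set I := nb P A :&: nb P B.
have nbU : #|nb P A| + #|nb P B| <= #|nb contract (A :|: B)| + (#|I|).+2.
  rewrite -cardsUI -/I.
  suff : #|nb P A :|: nb P B| <= #|nb contract (A :|: B)| + 2 by lia.
  suff /subset_leq_card le1 :
      nb P A :|: nb P B \subset nb contract (A :|: B) :|: [set A; B].
    apply: leq_trans le1 _; apply: leq_trans (leq_card_setU _ _) _.
    by rewrite leq_add2l cards2 ltnS leq_b1.
  apply/subsetP => X XN; rewrite !inE.
  have [-> //|XA] := eqVneq X A; first by rewrite !orbT.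
  have [-> //|XB] := eqVneq X B; first by rewrite !orbT.
  have XP : X \in P by move: XN; rewrite !inE => /orP[]/and3P[].
  have X0 : X \in P0 by rewrite !inE XA XB.
  have -> : X != A :|: B.
    by apply: contraNneq contract_notin => <-.
  rewrite touchUl XP orbT !andTb orbF.
  by move: XN; rewrite !inE => /orP[]/and3P[_ _ ->]; rewrite ?orbT.
have nb0 : \sum_(X in P0) #|nb P X| <=
           \sum_(X in P0) #|nb contract X| + #|I|.
  have -> : #|I| = \sum_(X in P0) (X \in I).
    rewrite -sum1_card [RHS]big_mkcond [LHS]big_mkcond /=; apply: eq_bigr => X _.
    rewrite !inE; case: (X \in P); case: (X == A); case: (X == B) => //=;
    by case: (touch A X); case: (touch B X).
  rewrite -big_split /=; apply: leq_sum => X X0.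
  have [XB XA XP] : [/\ X != B, X != A & X \in P].
    by move: X0; rewrite !inE => /and3P[].
  have XU : A :|: B != X.
    by apply: contraNneq contract_notin => ->.
  have -> : nb contract X =
      (if touch X A || touch X B then [set A :|: B] else set0) :|:
      (nb P X :\ A :\ B).
    apply/setP => Y; rewrite !inE.
    have [->|YU] /= := eqVneq Y (A :|: B).
      rewrite XU touchC touchUl touchC (touchC B).
      case: ifP => H; rewrite !inE ?eqxx //=.
      by case: (touch X A) H => //=; case: (touch X B) => //= _;
         rewrite !andbF.
    have -> : Y \in (if touch X A || touch X B then [set A :|: B] else set0)
               = false by case: ifP; rewrite !inE // (negbTE YU).
    by rewrite -!andbA.
  rewrite cardsU disjoint_setI0 ?cards0 ?subn0; last first.
    case: ifP => _; last by rewrite -setI_eq0 set0I.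
    rewrite disjoints1 !inE; apply/negP => /and5P[a b c _ _].
    by move: contract_notin; rewrite !inE a b c.
  have eA : (A \in nb P X) = touch X A by rewrite inE AP eq_sym XA.
  have eB : (B \in nb P X :\ A) = touch X B.
    by rewrite !inE BP (eq_sym B A) AB (eq_sym B X) XB.
  have eI : (X \in I) = touch X A && touch X B.
    by rewrite !inE XP XA XB (touchC A) (touchC B).
  rewrite (cardsD1 A (nb P X)) (cardsD1 B (nb P X :\ A)) eA eB eI.
  rewrite (fun_if (fun Y : {set {set G}} => #|Y|)) cards1 cards0.
  by move: (touch X A) (touch X B) #|_ :\ _| => [] [] n /=; clear; lia.
apply: leq_trans (leq_add nbU nb0) _; rewrite -/P0 -addnn.
by move: #|_| (\sum_(_ in _) _) #|_| => a b d; clear; lia.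
Qed.

Lemma clique_contract h : clique_over h contract -> clique_over h P.
Proof.
have sC : cover contract \subset cover P.
  apply/bigcupsP => X /setU1P[->|].
    by rewrite subUset !bigcup_sup.
  by rewrite !inE => /and3P[_ _ XP]; apply: bigcup_sup.
move=> [K [cK dK sK]]; exists K; split=> // i; have [s1 [X X1 X2]] := sK i.
split; first exact: subset_trans sC.
move: X1 => /setU1P[eX|]; last by rewrite !inE => /and3P[_ _ XP]; exists X.
by exists A => //; apply: subset_trans X2; rewrite eX subsetUl.
Qed.

End Contract.

(* Mader's argument: contracting an edge whose ends have few common neighbours
   keeps the density; otherwise every neighbourhood is dense. *)
Lemma dense_clique h P : branch_family P -> P != set0 ->
  2 ^ h * #|P| <= npairs P -> clique_over h P.
Proof.
elim: h P => [|h IHh] P.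
  by move=> _ _ _; exists (fun=> set0); split=> -[].
have [n] := ubnP #|P|; elim: n P => // n IHn P ltP fP P0 dP.
have [[A [B [AP BP AB tAB lt]]]|noC] : (exists A B, [/\ A \in P, B \in P,
   A != B, touch A B & #|nb P A :&: nb P B| < 2 ^ h]) \/
   {in P &, forall A B, A != B -> touch A B -> 2 ^ h <= #|nb P A :&: nb P B|}.
- case: (boolP [exists A in P, exists B in P, [&& A != B, touch A B &
    #|nb P A :&: nb P B| < 2 ^ h]]) => [/exists_inP[A AP]|/exists_inPn noC].
    by case/exists_inP => B BP /and3P[AB tAB lt]; left; exists A, B.
  right=> A B AP BP AB tAB; have /exists_inPn/(_ B BP) := noC A AP.
  by rewrite AB tAB /= -leqNgt.
- apply: (@clique_contract _ A B) => //.
  have cc := card_contract fP AP BP AB; apply: IHn; first by rewrite -ltnS -cc.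
  + exact: contract_family.
  + by apply/set0Pn; exists (A :|: B); rewrite !inE eqxx.
  (* The loss is at most [2 * 2 ^ h], exactly what the required bound [2 ^ h.+1 * #|P|] drops by
     when [#|P|] drops by one. *)
  + have := npairs_contract fP AP BP AB tAB; move: dP; rewrite cc expnS -muln2.
    rewrite mulnS => d1 d2; have := leq_trans d1 d2; move: lt.
    move=> lt' le'; rewrite -(leq_add2l (2 * 2 ^ h)); apply: leq_trans le' _.
    by rewrite addnC leq_add2r mulnC leq_mul2l lt'.
have [A AP nA0] : exists2 A, A \in P & nb P A != set0.
  apply/exists_inP; apply: contraTT dP => /exists_inPn dP.
  rewrite -ltnNge /npairs big1 => [|A AP].
    by rewrite muln_gt0 expn_gt0 card_gt0.
  by have /negPn/eqP -> := dP A AP; rewrite cards0.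
have sN : nb P A \subset P by apply/subsetP => B; rewrite inE => /andP[].
have [|K [cK dK sK]] := IHh (nb P A) (branch_familyS sN fP) nA0.
  rewrite /npairs mulnC -sum_nat_const; apply: leq_sum => B BN.
  have [BP BA tAB] : [/\ B \in P, B != A & touch A B].
    by move: BN; rewrite inE => /and3P[].
  apply: leq_trans (noC A B AP BP _ tAB) _; first by rewrite eq_sym.
  apply/subset_leq_card/subsetP => C; rewrite !inE.
  by move=> /andP[/and3P[-> -> ->] /and3P[_ -> ->]].
have dA i : [disjoint A & K i].
  rewrite disjoint_sym; apply: disjointWl (sK i).1 _.
  rewrite disjoint_sym disjoints_subset; apply/subsetP => x xA.
  rewrite inE; apply/negP => /bigcupP[B]; rewrite inE => /and3P[BP BA _] xB.
  by have := fP.2 B A BP AP BA => /pred0P/(_ x); rewrite /= xA xB.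
have tA i : touch A (K i).
  have [_ [B BN BK]] := sK i; move: BN; rewrite inE => /and3P[_ _].
  exact: touchS.
exists (fun i => if unlift ord0 i is Some j then K j else A); split.
- by move=> i; case: unliftP => [j _|_]; [apply: cK|apply: fP.1].
- move=> i j; case: (unliftP ord0 i) => [i' ->|->];
    case: (unliftP ord0 j) => [j' ->|->] //.
  + by rewrite (inj_eq lift_inj) => /dK.
  + by rewrite disjoint_sym dA touchC tA.
  + by rewrite dA tA.
- move=> i; case: unliftP => [j _|_].
    have [s1 [B BN BK]] := sK j; split; last by exists B => //; apply: (subsetP sN).
    apply: subset_trans s1 _; apply/bigcupsP => C /(subsetP sN) CP.
    exact: bigcup_sup.
  by split; [apply: bigcup_sup|exists A].
Qed.

Lemma dense_minor (H : sgraph) P : branch_family P -> P != set0 ->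
  2 ^ #|H| * #|P| <= npairs P -> minor H G.
Proof.
move=> fP P0 dP; have [K [cK dK _]] := dense_clique fP P0 dP.
have ne a b : a != b :> H -> enum_rank a != enum_rank b.
  by rewrite (inj_eq enum_rank_inj).
exists (fun a : H => K (enum_rank a)); split=> [a|a b /ne/dK/andP[]|a b ab] //.
have /ne/dK/andP[_ /touchP //] : a != b.
by apply: contraTneq ab => ->; rewrite adj_irrefl.
Qed.

End Density.

(** * Walks and rooted trees *)

(** The bound on out-degrees passes to subsets, and by double counting some vertex of each nonempty
    subset has in-degree at most [k]. Such vertices are chosen greedily, each discarding its at most
    [2 * k] neighbours. *)
Lemma indep_set (T : finType) (k : nat) (e : rel T) (X : {set T}) :
  {in X, forall x, #|[set y in X | e x y]| <= k} ->
  exists2 I : {set T}, I \subset X &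
    {in I &, forall x y, x != y -> ~~ e x y} /\ #|X| <= (2 * k).+1 * #|I|.
Proof.
have [n] := ubnP #|X|; elim: n X => // n IHn X ltX outX.
have [->|X0] := eqVneq X set0.
  exists set0 => //; split; last by rewrite !cards0 muln0.
  by move=> x y; rewrite inE.
have [x xX inx] : exists2 x, x \in X & #|[set y in X | e y x]| <= k.
  apply/exists_inP; apply: contraLR X0 => /exists_inPn noX.
  have : \sum_(x in X) k.+1 <= \sum_(x in X) k.
    apply: (@leq_trans (\sum_(x in X) #|[set y in X | e y x]|)).
      by apply: leq_sum => x /noX; rewrite -ltnNge.
    apply: (@leq_trans (\sum_(x in X) #|[set y in X | e x y]|)); last exact: leq_sum.
    pose F (x y : T) : nat := e x y.
    have -> : \sum_(x in X) #|[set y in X | e y x]| =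
              \sum_(x in X) \sum_(y in X) F y x.
      apply: eq_bigr => x _; rewrite -sum1dep_card big_mkcondr /=.
      by apply: eq_bigr => y _; rewrite /F; case: (e y x).
    rewrite exchange_big /=; apply: leq_sum => x _.
    rewrite -sum1dep_card big_mkcondr /=; apply: leq_sum => y _.
    by rewrite /F; case: (e x y).
  rewrite !sum_nat_const leq_mul2l ltnn orbF => /eqP/cards0_eq ->.
  by rewrite eqxx.
pose Z := x |: ([set y in X | e y x] :|: [set y in X | e x y]).
have Zk : #|Z| <= (2 * k).+1.
  rewrite /Z; apply: leq_trans (leq_card_setU _ _) _; rewrite cards1 add1n ltnS.
  apply: leq_trans (leq_card_setU _ _) _.
  by rewrite mul2n -addnn leq_add ?outX.
have XZ : #|X| <= #|Z| + #|X :\: Z|.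
  by rewrite -(cardsID Z X) leq_add2r subset_leq_card ?subsetIr.
have xZ : x \in Z by rewrite !inE eqxx.
have [|y /setDP[yX _]|I sI [iI cI]] := IHn (X :\: Z).
- rewrite ltnS in ltX; apply: leq_trans ltX; apply: proper_card.
  apply/properP; split; first exact: subsetDl.
  by exists x => //; rewrite inE xZ.
- apply: leq_trans (outX y yX); apply: subset_leq_card.
  by apply/subsetP => z; rewrite !inE => /andP[/andP[_ ->] ->].
have nI : x \notin I.
  by apply/negP => /(subsetP sI); rewrite inE xZ.
exists (x |: I).
  rewrite subUset sub1set xX; apply: subset_trans sI _; exact: subsetDl.
have nxI y : y \in I -> ~~ e x y && ~~ e y x.
  move=> /(subsetP sI) /setDP[yX]; rewrite !inE yX /=.
  by case/norP => _ /norP[-> ->].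
split.
  move=> y z /setU1P[->|yI] /setU1P[->|zI]; rewrite ?eqxx // => yz.
  - by have /andP[] := nxI z zI.
  - by have /andP[] := nxI y yI.
  - exact: iI.
rewrite cardsU1 nI mulnDr muln1; apply: leq_trans XZ _.
exact: leq_add.
Qed.

Local Open Scope ring_scope.

(** * Walks of bounded length along edges of a given kind *)

Section Walks.
Variables (R : realType) (G : sgraph) (w : G -> G -> R).
Hypothesis ew : edge_weighting w.
Implicit Types (P Q : rel G) (x y z : G) (r : R).

Lemma w_sym x y : adj x y -> w x y = w y x.
Proof. by move/ew => []. Qed.

Lemma w_ge0 x y : adj x y -> 0 <= w x y.
Proof. by move/ew => []. Qed.

Lemma walk_length_cat x p q :
  walk_length w x (p ++ q) = walk_length w x p + walk_length w (last x p) q.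
Proof. by elim: p x => [|y p IHp] x /=; rewrite ?add0r // IHp addrA. Qed.

Lemma walk_length_ge0 x p : path adj x p -> 0 <= walk_length w x p.
Proof.
by elim: p x => //= y p IHp x /andP[xy py]; rewrite addr_ge0 ?w_ge0 ?IHp.
Qed.

Lemma walk_length_rev x p : path adj x p ->
  walk_length w (last x p) (rev (belast x p)) = walk_length w x p.
Proof.
elim: p x => //= y p IHp x /andP[xy py].
rewrite rev_cons -cats1 walk_length_cat IHp //= addr0 addrC; congr (_ + _).
case: p {IHp} py => [|z p] /= py; first by rewrite w_sym // adj_sym.
by rewrite rev_cons last_rcons w_sym // adj_sym.
Qed.

(** Upper bounds on lengths stand in for distances: they add up under concatenation, and no shortest
    walk has to be selected. *)
Definition wconn P x y r := exists p,
  [/\ path [rel a b | adj a b && P a b] x p, last x p = y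
    & walk_length w x p <= r].

Lemma wconn_refl P x r : 0 <= r -> wconn P x x r.
Proof. by exists [::]. Qed.

Lemma wconn_step P x y : adj x y -> P x y -> wconn P x y (w x y).
Proof. by move=> xy pxy; exists [:: y]; rewrite /= xy pxy addr0. Qed.

Lemma wconn_trans P x y z r s :
  wconn P x y r -> wconn P y z s -> wconn P x z (r + s).
Proof.
move=> [p [pp lp wp]] [q [pq lq wq]]; exists (p ++ q).
by rewrite cat_path last_cat walk_length_cat lp pp pq lq lerD.
Qed.

Lemma wconn_le P x y r s : r <= s -> wconn P x y r -> wconn P x y s.
Proof. by move=> rs [p [pp lp wp]]; exists p; split=> //; apply: le_trans rs. Qed.

Lemma wconn_sub P Q x y r :
  (forall a b, adj a b -> P a b -> Q a b) -> wconn P x y r -> wconn Q x y r.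
Proof.
move=> sPQ [p [pp lp wp]]; exists p; split=> //.
apply: sub_path pp => a b /= /andP[ab pab]; rewrite ab; exact: sPQ.
Qed.

Lemma wconn_sym P x y r : (forall a b, adj a b -> P a b -> P b a) ->
  wconn P x y r -> wconn P y x r.
Proof.
move=> sP [p [pp lp wp]]; exists (rev (belast x p)); split.
- rewrite -lp rev_path; apply: sub_path pp => a b /= /andP[ab pab].
  by rewrite adj_sym ab sP.
- by case: p {pp wp} lp => //= z p _; rewrite rev_cons last_rcons.
rewrite -lp walk_length_rev //.
by apply: sub_path pp => a b /= /andP[].
Qed.

End Walks.

(** * Trees given by parent functions *)

Section Rooted.
Variables (R : realType) (G : sgraph) (w : G -> G -> R) (r : G).
Hypothesis ew : edge_weighting w.
Implicit Types (par : G -> G) (rk : G -> nat) (F X : {set G}).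

(* The rank [rk] makes the parent function [par] acyclic; its injectivity is
   used to compare vertices that are not related in the tree. *)
Definition rooted par rk := [/\ par r = r, injective rk
  & forall v, v != r -> adj v (par v) /\ (rk (par v) < rk v)%N].

Definition wpar par v : R := if v == r then 0 else w v (par v).

Fixpoint plen par n v : R :=
  if n is n'.+1 then wpar par v + plen par n' (par v) else 0.

(** Nearness is measured along the tree, so a vertex outside [F] keeps its way to [F] when only
    vertices of [F] get new parents. *)
Definition covered par F rho :=
  forall v, exists2 n, iter n par v \in F & plen par n v <= rho.

Lemma wpar_ge0 par rk v : rooted par rk -> 0 <= wpar par v.
Proof.
by rewrite /wpar => -[_ _ H]; case: eqVneq => // /H [/(w_ge0 ew)].
Qed.

Lemma plen_ge0 par rk n v : rooted par rk -> 0 <= plen par n v.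
Proof.
by move=> rp; elim: n v => //= n IHn v; rewrite addr_ge0 ?(wpar_ge0 _ rp).
Qed.

Definition link (E : {set G * G}) := [rel x y | ((x, y) \in E) || ((y, x) \in E)].

Lemma grow_tree (X : {set G}) (E : {set G * G}) : r \in X ->
  {in E, forall e, [/\ e.1 \in X, e.2 \in X & adj e.1 e.2]} ->
  {in X, forall v, connect (link E) r v} ->
  exists par (rk : G -> nat), [/\ par r = r, {in X &, injective rk},
    {in X, forall v, v != r ->
       [/\ par v \in X, link E v (par v) & (rk (par v) < rk v)%N]},
    {in X, forall v, (rk v < #|X|)%N}
  & \sum_(v in X) wpar par v <= \sum_(e in E) w e.1 e.2].
Proof.
move=> rX EX cX.
(* Only edges with both ends in [Y] are counted, so the edge that brings in the next vertex has not
   been used yet. Ranks below [#|Y|] leave [#|Y|] itself for that vertex. *)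
pose Inv (Y : {set G}) := r \in Y /\
  exists par (rk : G -> nat), [/\ par r = r, {in Y &, injective rk},
    {in Y, forall v, v != r ->
       [/\ par v \in Y, link E v (par v) & (rk (par v) < rk v)%N]},
    {in Y, forall v, (rk v < #|Y|)%N}
  & \sum_(v in Y) wpar par v <=
    \sum_(e in E | (e.1 \in Y) && (e.2 \in Y)) w e.1 e.2].
have InvX : Inv X.
  suff grow n : (0 < n <= #|X|)%N ->
      exists2 Y : {set G}, Y \subset X & Inv Y /\ #|Y| = n.
    have [|Y sY [IY cY]] := grow #|X|.
      by rewrite leqnn (cardD1 r) rX.
    by have /eqP <- : Y == X by rewrite eqEcard sY cY leqnn.
  case: n => // n; elim: n => [_|n IHn ltn].
    exists [set r]; first by rewrite sub1set.
    split; last by rewrite cards1.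
    split; first by rewrite inE.
    exists id, (fun=> 0%N); split=> //.
    - by move=> x y /set1P-> /set1P->.
    - by move=> v /set1P->; rewrite eqxx.
    - by move=> v _; rewrite cards1.
    rewrite big_set1 /wpar eqxx; apply: sumr_ge0 => e /andP[/EX[_ _ a] _].
    exact: w_ge0.
  have [|Y sY [[rY [par [rk [pr irk pY rkY sumY]]]] cY]] := IHn.
    by apply: leq_trans ltn; rewrite ltnS.
  have [x [y [xY yY xy]]] : exists x y, [/\ x \in Y, y \notin Y & link E x y].
    have [z zX zY] : exists2 z, z \in X & z \notin Y.
      apply/subsetPn; apply/negP => /subset_leq_card.
      by rewrite cY leqNgt; case/andP: ltn => _ ->.
    have /connectP[p pp lp] := cX z zX; rewrite {z zX}lp in zY.
    elim: p (r) rY pp zY => [|z p IHp] u uY /=; first by rewrite uY.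
    move=> /andP[uz pp] lY; have [zY|zY] := boolP (z \in Y).
      exact: IHp zY pp lY.
    by exists u, z.
  have yX : y \in X by case/orP: xy => /EX[].
  have axy : adj x y by case/orP: xy => /EX[] //=; rewrite adj_sym.
  have yr : y != r by apply: contraNneq yY => ->.
  have yv v : v \in Y -> (v == y) = false.
    by move=> vY; apply: contraNF yY => /eqP <-.
  have cyY : #|y |: Y| = n.+2 by rewrite cardsU1 yY cY.
  exists (y |: Y); first by rewrite subUset sub1set yX.
  split=> //; split; first by rewrite !inE rY orbT.
  exists (fun v => if v == y then x else par v),
         (fun v => if v == y then n.+1 else rk v); split.
  - by rewrite eq_sym (negbTE yr).
  - move=> u v /setU1P[->|uY] /setU1P[->|vY]; rewrite ?eqxx ?yv //.
    + by move=> e; have := rkY v vY; rewrite cY -e ltnn.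
    + by move=> e; have := rkY u uY; rewrite cY e ltnn.
    + exact: irk.
  - move=> v /setU1P[->|vY]; rewrite ?eqxx ?(yv v) // => vr.
      rewrite (yv x) // !inE xY orbT /= orbC; split=> //.
      by rewrite ltnS -ltnS -cY; apply: rkY.
    by have [a b c] := pY v vY vr; rewrite (yv _ a) !inE a orbT.
  - move=> v; rewrite cyY => /setU1P[->|vY]; rewrite ?eqxx ?yv //.
    by have := rkY v vY; rewrite cY; lia.
  rewrite big_setU1 //= /wpar eqxx (negbTE yr).
  have -> : \sum_(v in Y) (if v == r then 0 else
       w v (if v == y then x else par v)) = \sum_(v in Y) wpar par v.
    by apply: eq_bigr => v vY; rewrite yv.
  have [e0 e0E we0] : exists2 e0 : G * G, e0 \in E &
      w e0.1 e0.2 = w y x /\ (e0 = (x, y) \/ e0 = (y, x)).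
    case/orP: xy => xyE; [exists (x, y)|exists (y, x)] => //=; split; auto.
    exact: w_sym.
  rewrite (bigD1 e0) /=; last first.
    by rewrite e0E; case: we0.2 => ->; rewrite /= !inE eqxx xY ?orbT.
  rewrite we0.1 lerD2l; apply: le_trans sumY _.
  rewrite [leRHS]big_mkcond [leLHS]big_mkcond; apply: ler_sum => e _.
  have [eE|] //= := boolP (e \in E).
  case: ifP => [/andP[e1 e2]|_]; last first.
    by case: ifP => // _; apply: (w_ge0 ew); have [] := EX e eE.
  rewrite !inE e1 e2 !orbT /=.
  have -> // : e != e0.
  apply/negP => /eqP ee; move: e1 e2; rewrite ee.
  by case: we0.2 => -> /=; rewrite (negbTE yY).
have [_ [par [rk [pr irk pX rkX sumX]]]] := InvX.
exists par, rk; split=> //; apply: le_trans sumX _.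
rewrite [leRHS]big_mkcond [leLHS]big_mkcond; apply: ler_sum => e _.
have [eE|] //= := boolP (e \in E).
by case: ifP => // _; apply: (w_ge0 ew); have [] := EX e eE.
Qed.

(** The vertices of [X] take their parents from a tree grown inside [E], all others keep theirs. An
    old path to [X] remains valid up to its first vertex in [X]. *)
Lemma rebuild par rk (X : {set G}) (E : {set G * G}) rho : rooted par rk ->
  r \in X ->
  {in E, forall e, [/\ e.1 \in X, e.2 \in X & adj e.1 e.2]} ->
  {in X, forall v, connect (link E) r v} ->
  covered par X rho ->
  exists par' rk', [/\ rooted par' rk', {in X, forall v, par' v \in X},
    covered par' X rho, \sum_(v in X) wpar par' v <= \sum_(e in E) w e.1 e.2
  & forall v, v != r -> par' v = par v \/ link E v (par' v)].
Proof.
move=> [pr irk prk] rX EX cX cov.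
have [p1 [rk1 [p1r irk1 p1X rk1X sum1]]] := grow_tree rX EX cX.
pose p2 v := if v \in X then p1 v else par v.
(* The offset puts every vertex outside [X] above all of [X], so that an old parent has smaller rank
   also if it lies in [X]. *)
pose rk2 v := (if v \in X then rk1 v else #|X| + rk v)%N.
have p2X v : v \in X -> p2 v \in X.
  move=> vX; rewrite /p2 vX; have [->|vr] := eqVneq v r; first by rewrite p1r.
  by have [] := p1X v vX vr.
exists p2, rk2; split=> //.
- split; first by rewrite /p2 rX.
  + move=> u v; rewrite /rk2; case: ifP => uX; case: ifP => vX.
    * exact: irk1.
    * by move=> e; have := rk1X u uX; rewrite e -ltn_subRL subnn.
    * by move=> e; have := rk1X v vX; rewrite -e -ltn_subRL subnn.
    * by move/addnI/irk.
  + move=> v vr; rewrite /p2 /rk2; case: ifP => vX.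
      have [a b c] := p1X v vX vr; rewrite a; split=> //.
      by case/orP: b => /EX[] //=; rewrite adj_sym.
    have [a b] := prk v vr; split=> //; case: ifP => pX.
      exact: leq_trans (rk1X _ pX) (leq_addr _ _).
    by rewrite ltn_add2l.
- move=> v; have [n nX nrho] := cov v.
  suff [m mX mle] : exists2 m, iter m p2 v \in X & plen p2 m v <= plen par n v.
    by exists m => //; apply: le_trans nrho.
  elim: n v {nrho} nX => [|n IHn] v /= nX; first by exists 0%N.
  have [vX|vX] := boolP (v \in X).
    exists 0%N => //=; rewrite -[leRHS]/(plen par n.+1 v).
    by apply: (@plen_ge0 _ rk); split.
  rewrite -iterS iterSr in nX; have [m mX mle] := IHn _ nX.
  exists m.+1; rewrite ?iterSr /= /p2 (negbTE vX) //.
  by rewrite /wpar (negbTE vX) lerD2l.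
- apply: le_trans sum1; apply: ler_sum => v vX.
  by rewrite /wpar /p2 vX.
- move=> v vr; rewrite /p2; case: ifP => vX; last by left.
  by right; have [] := p1X v vX vr.
Qed.

End Rooted.

(** * Clusters of the core at a given scale *)

Section ParentFold.
Variables (G : sgraph) (r : G) (par : G -> G) (rk : G -> nat).
Variables (T : Type) (f : G -> T -> T) (x0 : T).

Fixpoint par_iter n v : T :=
  if n is n'.+1 then if v == r then x0 else f v (par_iter n' (par v)) else x0.

(** The rank drops with each step to the parent, so this much fuel suffices to reach the root. *)
Definition par_fold v := par_iter (rk v).+1 v.

Lemma par_foldr : par_fold r = x0.
Proof. by rewrite /par_fold /= eqxx. Qed.

Lemma par_foldE v : rooted r par rk -> v != r ->
  par_fold v = f v (par_fold (par v)).
Proof.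
move=> [_ _ prk] vr; rewrite /par_fold.
have iterE n m x : (rk x < n)%N -> (rk x < m)%N -> par_iter n x = par_iter m x.
  elim: n m x => // n IHn [//|m] x ltn ltm /=; case: eqVneq => // xr.
  by have [_ lt] := prk x xr; congr (f _ _); apply: IHn; lia.
rewrite {1}[LHS]/= (negbTE vr); congr (f _ _); apply: iterE => //.
by have [] := prk v vr.
Qed.

End ParentFold.

Lemma par_ind (G : sgraph) (r : G) par rk :
  rooted r par rk -> forall P : G -> Prop,
  P r -> (forall v, v != r -> P (par v) -> P v) -> forall v, P v.
Proof.
move=> [_ _ prk] P Pr IH v; have [n] := ubnP (rk v); elim: n v => // n IHn v ltn.
have [->//|vr] := eqVneq v r; apply: IH => //; apply: IHn.
by have [_ lt] := prk v vr; apply: leq_trans lt ltn.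
Qed.

Arguments par_ind [G r par rk] _ P _ _ v.

Section Clusters.
Variables (R : realType) (G : sgraph) (w : G -> G -> R) (r : G).
Variables (par : G -> G) (rk : G -> nat) (F : {set G}) (u : R).
Hypothesis ew : edge_weighting w.
Hypothesis rp : rooted r par rk.
Hypothesis rF : r \in F.
Hypothesis upF : {in F, forall v, par v \in F}.
Hypothesis u_gt0 : 0 < u.
Hypothesis cov : covered w r par F u.

Local Notation wp := (wpar w r par).

Lemma rk_par v : v != r -> (rk (par v) < rk v)%N.
Proof. by have [_ _ H] := rp => /H []. Qed.

Lemma adj_par v : v != r -> adj v (par v).
Proof. by have [_ _ H] := rp => /H []. Qed.

Lemma wp_ge0 v : 0 <= wp v.
Proof. exact: wpar_ge0 rp. Qed.

(* [F] is the core; [dep] measures distances to the root along core edges only,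
   so that the vertices hanging from the core do not start clusters. *)
Definition wcore v : R := if v \in F then wp v else 0.

Lemma wcore_ge0 v : 0 <= wcore v.
Proof. by rewrite /wcore; case: ifP => // _; apply: wp_ge0. Qed.

Definition dep := par_fold r par rk (fun v d => d + wcore v) 0.
Definition hang := par_fold r par rk
  (fun v d => if v \in F then 0 else d + wp v) 0.

Lemma dep_r : dep r = 0. Proof. exact: par_foldr. Qed.
Lemma depE v : v != r -> dep v = dep (par v) + wcore v.
Proof. exact: par_foldE. Qed.
Lemma hangF v : v \in F -> hang v = 0.
Proof.
have [->|vr] := eqVneq v r; first by move=> _; exact: par_foldr.
by move=> vF; rewrite /hang par_foldE // vF.
Qed.
Lemma hangNF v : v \notin F -> hang v = hang (par v) + wp v.
Proof.
move=> vF; rewrite {1}/hang par_foldE ?(negbTE vF) //.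
by apply: contraNneq vF => ->.
Qed.
Lemma hang_ge0 v : 0 <= hang v.
Proof.
elim/(par_ind rp): v => [|v vr IH]; first by rewrite hangF.
have [vF|vF] := boolP (v \in F); first by rewrite hangF.
by rewrite hangNF // addr_ge0 // wp_ge0.
Qed.
Lemma hang_le v : hang v <= u.
Proof.
have [n nF le] := cov v; apply: le_trans le.
elim: n v nF => [|n IHn] v nF; first by rewrite hangF.
have [vF|vF] := boolP (v \in F).
  by rewrite hangF //; apply: plen_ge0 ew _ _ _ _ rp.
by rewrite hangNF //= addrC lerD2l IHn // -iterSr.
Qed.

(** As [F] is closed under parents, a path to the root never leaves the core again once it has
    entered it; the sum is thus the distance to the root in the whole tree. *)
Definition depth v := dep v + hang v.
Lemma depthE v : v != r -> depth v = depth (par v) + wp v.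
Proof.
move=> vr; rewrite /depth depE // /wcore.
have [vF|vF] := boolP (v \in F); first by rewrite !hangF ?upF // !addr0.
by rewrite addr0 [hang v]hangNF // addrA.
Qed.

(* The core is cut greedily from the root: a piece starts at [v] as soon as [v]
   is at core distance [u] from the top of the piece of its parent. *)
Definition top := par_fold r par rk
  (fun v t => if u <= dep v - dep t then v else t) r.

Lemma top_r : top r = r. Proof. exact: par_foldr. Qed.
Lemma topE v : v != r ->
  top v = if u <= dep v - dep (top (par v)) then v else top (par v).
Proof. exact: par_foldE. Qed.

Lemma rk_top v : (rk (top v) <= rk v)%N.
Proof.
elim/(par_ind rp): v => [|v vr IH]; first by rewrite top_r.
rewrite topE //; case: ifP => // _; apply: leq_trans IH _.
exact: ltnW (rk_par vr).
Qed.

Lemma top_top v : top (top v) = top v.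
Proof.
elim/(par_ind rp): v => [|v vr IH]; first by rewrite !top_r.
by rewrite [top v]topE //; case: ifP => // h; rewrite topE // h.
Qed.

Lemma dep_top v : dep (top v) <= dep v < dep (top v) + u.
Proof.
elim/(par_ind rp): v => [|v vr IH]; first by rewrite top_r lexx ltrDl.
rewrite topE //; case: ifP => [_|/negbT]; first by rewrite lexx ltrDl.
rewrite -ltNge ltrBlDl => ->; rewrite andbT (depE vr).
by have /andP[le _] := IH; have := wcore_ge0 v; lra.
Qed.

Lemma top_core v : top v \in F.
Proof.
elim/(par_ind rp): v => [|v vr IH]; first by rewrite top_r.
rewrite topE //; case: ifP => // h; apply: contraLR h => vF.
by rewrite depE // /wcore (negbTE vF) addr0 -ltNge; have /andP[_] := dep_top (par v); lra.
Qed.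

Definition long t := [&& t != r, t \in F & u < wp t].

Definition up t := top (par t).

(* A piece without pieces below it may be arbitrarily light.  It does not get a
   cluster of its own but is merged into the piece above it, unless the core
   edge that leads to it is long. *)
Definition node t := (top t == t) && [|| t == r, long t |
  [exists s, [&& s != r, top s == s & up s == t]]].

Definition cl v := if node (top v) then top v else up (top v).

Lemma up_r : up r = r.
Proof. by have [pr _ _] := rp; rewrite /up pr top_r. Qed.

Lemma rk_up t : t != r -> (rk (up t) < rk t)%N.
Proof. by move=> tr; apply: leq_ltn_trans (rk_top _) (rk_par tr). Qed.

Lemma node_r : node r.
Proof. by rewrite /node top_r !eqxx. Qed.

Lemma node_top t : node t -> top t = t.
Proof. by case/andP => /eqP. Qed.

Lemma node_up_top t : top t = t -> node (up t).
Proof.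
move=> tt; have [->|tr] := eqVneq t r; first by rewrite up_r node_r.
rewrite /node /up top_top eqxx /=; apply/or3P/Or33/existsP.
by exists t; rewrite tr tt !eqxx.
Qed.

Lemma node_up t : node t -> node (up t).
Proof. by move=> /node_top/node_up_top. Qed.

Lemma node_cl v : node (cl v).
Proof. by rewrite /cl; case: ifP => // _; apply: node_up_top; apply: top_top. Qed.

Lemma cl_node t : node t -> cl t = t.
Proof. by move=> nt; rewrite /cl node_top ?nt. Qed.

Lemma cl_cl v : cl (cl v) = cl v.
Proof. exact: cl_node (node_cl v). Qed.

Lemma cl_r : cl r = r. Proof. exact: cl_node node_r. Qed.

Lemma node_core t : node t -> t \in F.
Proof. by move=> /node_top <-; apply: top_core. Qed.

Lemma cl_core v : cl v \in F.
Proof. exact: node_core (node_cl v). Qed.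

Lemma rk_cl v : (rk (cl v) <= rk v)%N.
Proof.
rewrite /cl; case: ifP => [_|nt]; first exact: rk_top.
have [e|tr] := eqVneq (top v) r; first by rewrite e node_r in nt.
exact: leq_trans (ltnW (rk_up tr)) (rk_top v).
Qed.

Lemma up_cl t : node t -> up t = cl (par t).
Proof.
by move=> nt; rewrite /cl -/(up t) (node_up nt).
Qed.

Lemma cl_par v : v != r -> cl v = v \/ cl (par v) = cl v.
Proof.
move=> vr; have [e|ne] := eqVneq (top v) v; last first.
  have e : top v = top (par v).
    by move: ne; rewrite topE //; case: ifP; rewrite ?eqxx.
  by right; rewrite /cl e.
have [nv|nv] := boolP (node v); [by left; apply: cl_node|right].
by rewrite {2}/cl e (negbTE nv) /cl -/(up v) (node_up_top e).
Qed.

Lemma cl_par_neq v : v != r -> cl (par v) != cl v ->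
  [/\ node v, cl v = v & up v = cl (par v)].
Proof.
move=> vr; have [e _|->] := cl_par vr; last by rewrite eqxx.
have nv : node v by rewrite -e node_cl.
by split=> //; apply: up_cl.
Qed.

Lemma cl_par_id v : cl v != v -> [/\ v != r, cl (par v) = cl v & wp v <= u].
Proof.
move=> cv; have vr : v != r by apply: contraNneq cv => ->; rewrite cl_r.
split=> //; first by have [e|//] := cl_par vr; rewrite e eqxx in cv.
have [vF|vF] := boolP (v \in F); last first.
  by have := hang_le v; rewrite hangNF //; have := hang_ge0 (par v); lra.
rewrite leNgt; apply: contra cv => lv; rewrite cl_node //.
have wv : wcore v = wp v by rewrite /wcore vF.
rewrite /node /long vr vF lv /= orbT andbT topE // depE // wv.
by have /andP[? ?] := dep_top (par v); case: ifP => // /negbT; lra.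
Qed.

Lemma dep_up t : node t -> t != r -> u <= dep t - dep (up t).
Proof.
move=> /node_top e tr; move: e; rewrite topE // -/(up t).
by case: ifP => // _ e; have := rk_up tr; rewrite e ltnn.
Qed.

Lemma dep_up_lt t : top t = t -> t != r -> ~~ long t ->
  dep t - dep (up t) < 2 * u.
Proof.
move=> tt tr; have tF : t \in F by rewrite -tt top_core.
rewrite /long tr tF /= -leNgt => le; have /andP[_] := dep_top (par t).
by rewrite -/(up t) (depE tr) /wcore tF; lra.
Qed.

(** Less than [u] leads from [v] to the top of its piece, and less than [2 * u] further up if the
    piece is merged into the one above, since a piece below a long edge is never merged. *)
Lemma dep_cl v : 0 <= dep v - dep (cl v) < 3 * u.
Proof.
have /andP[? ?] := dep_top v; rewrite /cl; case: ifP => [_|nt].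
  by apply/andP; split; move: u_gt0; lra.
have tr : top v != r by apply: contraFneq nt => ->; exact: node_r.
have nl : ~~ long (top v).
  by apply: contraFN nt => l; rewrite /node top_top eqxx l orbT.
have := dep_up_lt (top_top v) tr nl.
have : u <= dep (top v) - dep (up (top v)).
  have := top_top v; rewrite {1}topE // -/(up _).
  by case: ifP => // _ e; have := rk_up tr; rewrite e ltnn.
by move=> ? ?; apply/andP; split; move: u_gt0; lra.
Qed.

(** The fourth [u] pays for the part of the path outside the core. *)
Lemma depth_cl v : 0 <= depth v - depth (cl v) <= 4 * u.
Proof.
rewrite /depth (hangF (cl_core v)).
have /andP[? ?] := dep_cl v; have := hang_le v; have := hang_ge0 v => ? ?.
by apply/andP; split; lra.
Qed.

Definition light : rel G := [rel x y | w x y <= u].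

Lemma wconn_light_sym x y l : wconn w light x y l -> wconn w light y x l.
Proof.
by apply: wconn_sym => // a b ab; rewrite /light /= (w_sym ew ab).
Qed.

(** Tree edges inside a cluster are light: the lower end of a long core edge is a node, and a path
    outside the core has length at most [u] in all. *)
Lemma wconn_cl v : wconn w light v (cl v) (depth v - depth (cl v)).
Proof.
elim/(par_ind rp): v => [|v vr IH]; first by rewrite cl_r subrr; apply: wconn_refl.
have [e|ne] := eqVneq (cl v) v; first by rewrite e subrr; apply: wconn_refl.
have [_ e le] := cl_par_id ne; rewrite -e depthE //.
have -> : depth (par v) + wp v - depth (cl (par v)) =
  wp v + (depth (par v) - depth (cl (par v))) by ring.
apply: wconn_trans IH; have -> : wp v = w v (par v) by rewrite /wpar (negbTE vr).
apply: wconn_step; first exact: adj_par.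
by move: le; rewrite /wpar (negbTE vr).
Qed.

Lemma wconn_up t : node t -> t != r -> ~~ long t ->
  wconn w light t (up t) (dep t - dep (up t)).
Proof.
move=> nt tr nl; have tF := node_core nt.
have le : wp t <= u by move: nl; rewrite /long tr tF /= leNgt.
have -> : dep t - dep (up t) = wp t + (depth (par t) - depth (cl (par t))).
  rewrite /depth !hangF ?upF ?cl_core // -up_cl // depE // /wcore tF; ring.
rewrite up_cl //; apply: wconn_trans (wconn_cl _).
have -> : wp t = w t (par t) by rewrite /wpar (negbTE tr).
apply: wconn_step; first exact: adj_par.
by move: le; rewrite /wpar (negbTE tr).
Qed.

Definition inner t : R := \sum_(v | (cl v == t) && (v != t)) wcore v.

Lemma inner_ge0 t : 0 <= inner t.
Proof. by apply: sumr_ge0 => v _; apply: wcore_ge0. Qed.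

Lemma dep_ge0 v : 0 <= dep v.
Proof.
elim/(par_ind rp): v => [|v vr IH]; first by rewrite dep_r.
by rewrite depE // addr_ge0 // wcore_ge0.
Qed.

(** Going up from [v], the path either leaves [S] at [a] or ends at the root, where [dep] is zero;
    until then its edges are distinct terms of the sum. *)
Lemma dep_chain (S : {set G}) a v :
  {in S, forall x, x != r -> par x \in S \/ par x = a} ->
  v \in S -> dep v - dep a <= \sum_(x in S) wcore x.
Proof.
move=> Sa vS.
have : dep v - dep a <= \sum_(x in S | (rk x <= rk v)%N) wcore x.
  elim/(par_ind rp): v vS => [|v vr IH] vS.
    rewrite dep_r; apply: (@le_trans _ _ 0); first by have := dep_ge0 a; lra.
    by apply: sumr_ge0 => x _; apply: wcore_ge0.
  rewrite (bigD1 v) /=; last by rewrite vS leqnn.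
  rewrite depE //; have [pS|->] := Sa v vS vr; last first.
    suff : 0 <= \sum_(x in S | (rk x <= rk v)%N && (x != v)) wcore x.
      by move=> h; under eq_bigl do rewrite -andbA; lra.
    by apply: sumr_ge0 => x _; apply: wcore_ge0.
  suff : \sum_(x in S | (rk x <= rk (par v))%N) wcore x <=
      \sum_(x in S | (rk x <= rk v)%N && (x != v)) wcore x.
    by have := IH pS => h1 h2; under eq_bigl do rewrite -andbA; lra.
  rewrite [leRHS]big_mkcond [leLHS]big_mkcond; apply: ler_sum => x _.
  case: ifP => [/andP[-> lx]|_]; last by case: ifP => // _; apply: wcore_ge0.
  have lt := rk_par vr; rewrite (leq_trans lx (ltnW lt)) /= ifT //.
  by apply: contraTneq lx => ->; rewrite -ltnNge.
move=> /le_trans -> //; rewrite [leRHS]big_mkcond [leLHS]big_mkcond.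
apply: ler_sum => x _; case: ifP => [/andP[-> _] //|_].
by case: ifP => // _; apply: wcore_ge0.
Qed.

Lemma dep_inner v : dep v - dep (cl v) <= inner (cl v).
Proof.
have [->|ne] := eqVneq v (cl v); first by rewrite cl_cl subrr inner_ge0.
pose S := [set x | (cl x == cl v) && (x != cl v)].
have -> : inner (cl v) = \sum_(x in S) wcore x.
  by apply: eq_bigl => x; rewrite inE.
apply: dep_chain; last by rewrite inE eqxx.
move=> x; rewrite inE => /andP[/eqP cx xv] xr.
have [] := @cl_par_id x; rewrite ?cx 1?eq_sym // => _ cpx _.
by rewrite inE cpx eqxx; have [|] := eqVneq (par x) (cl v); [right|left].
Qed.

(** * Leaves of the tree of clusters *)

Definition children t := [set s | [&& node s, s != r & up s == t]].

Definition leaf t := [&& node t, t != r, ~~ long t & children t == set0].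

(** What makes such a [t] a node is a piece below it that was merged into its cluster. The top of
    this piece is at core distance at least [u] from [t], and the path between them stays in the
    cluster. *)
Lemma leaf_inner t : leaf t -> u <= inner t.
Proof.
case/and4P => nt tr nl /eqP c0; move: (nt) => /andP[_ /or3P[|/idPn|]] //.
  by rewrite (negbTE tr).
case/existsP => s /and3P[sr /eqP ss /eqP us].
have ns : ~~ node s.
  apply/negP => ns; have : s \in children t by rewrite inE ns sr us eqxx.
  by rewrite c0 inE.
have cs : cl s = t by rewrite /cl ss (negbTE ns).
rewrite -cs; apply: le_trans (dep_inner s); rewrite cs -us.
move: (ss); rewrite topE // -/(up s).
by case: ifP => // _ e; have := rk_up sr; rewrite e ltnn.
Qed.

Definition tree_state par' rk' (F' : {set G}) rho := [/\ rooted r par' rk',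
  r \in F', {in F', forall v, par' v \in F'} & covered w r par' F' rho].

Variables (Q : rel G).
Hypothesis Q_sym : forall x y, adj x y -> Q x y -> Q y x.
Hypothesis Q_par : forall v, v != r -> Q v (par v).

(* [Q] is a property of edges, inherited by the new tree. *)
Definition improves (kappa : nat) (s : R) := exists par' rk' F',
  [/\ tree_state par' rk' F' (kappa%:R * u),
      \sum_(v in F') wpar w r par' v + s <= \sum_(v in F) wp v
    & forall v, v != r -> Q v (par' v)].

Lemma reach_cl v : exists2 n, iter n par v = cl v &
  plen w r par n v = depth v - depth (cl v).
Proof.
elim/(par_ind rp): v => [|v vr [n nv pn]]; first by exists 0%N; rewrite /= cl_r ?subrr.
have [e|ne] := eqVneq (cl v) v; first by exists 0%N; rewrite /= e ?subrr.
have [_ e le] := cl_par_id ne; exists n.+1; rewrite ?iterSr ?nv //=.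
by rewrite pn e (depthE vr); ring.
Qed.

Lemma reach_up t : node t -> t != r -> ~~ long t ->
  exists2 n, iter n par t = up t & plen w r par n t <= 2 * u.
Proof.
move=> nt tr nl; have [n nv pn] := reach_cl (par t); have tF := node_core nt.
exists n.+1; first by rewrite iterSr nv up_cl.
rewrite /= pn; have := dep_up_lt (node_top nt) tr nl; rewrite up_cl // => /ltW; apply: le_trans.
by rewrite /depth !hangF ?upF ?cl_core // (depE tr) /wcore tF; lra.
Qed.

Lemma plen_cat n m v :
  plen w r par (n + m) v = plen w r par n v + plen w r par m (iter n par v).
Proof.
elim: n v => [|n IHn] v /=; first by rewrite add0r.
by rewrite IHn addrA -iterS iterSr.
Qed.

Lemma sum_core : \sum_(v in F) wp v = \sum_v wcore v.
Proof. by rewrite big_mkcond. Qed.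

Lemma sum_wcore_le (P P' : pred G) : subpred P P' ->
  \sum_(v | P v) wcore v <= \sum_(v | P' v) wcore v.
Proof.
move=> PP; rewrite [leRHS]big_mkcond [leLHS]big_mkcond; apply: ler_sum => v _.
by case: ifP => [/PP ->//|_]; case: ifP => // _; apply: wcore_ge0.
Qed.

(** Leaf clusters shrink to their nodes. No remaining core vertex has its parent in the dropped
    part, because a leaf has no children. The 4 is the radius of a cluster. *)
Lemma leaf_improves : improves 4 (#|[set t | leaf t]|%:R * u).
Proof.
pose D := [set v | leaf (cl v) && (v != cl v)].
exists par, rk, (F :\: D); split=> //; first split=> //.
- by rewrite !inE rF cl_r eqxx andbF.
- move=> v /setDP[vF]; rewrite !inE upF // andbT => vD.
  have [e|vr] := eqVneq v r.
    by have [pr _ _] := rp; rewrite e pr cl_r eqxx andbF.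
  apply: contra vD => /andP[lv pv].
  have [e|e] := cl_par vr; last first.
    rewrite -e lv /=; apply: contraTneq pv => e2; have := rk_cl (par v).
    by rewrite -e2 leqNgt rk_par.
  have [e2|ne] := eqVneq (cl (par v)) (cl v).
    by have := rk_cl (par v); rewrite e2 e leqNgt rk_par.
  have [nv _ uv] := cl_par_neq vr ne; case/and4P: lv => _ _ _ /eqP c0.
  have : v \in children (cl (par v)) by rewrite inE nv vr uv eqxx.
  by rewrite c0 inE.
- move=> v; have [n nv pn] := reach_cl v; exists n.
    by rewrite nv !inE cl_core cl_cl eqxx andbF.
  by rewrite pn; have /andP[] := depth_cl v.
rewrite sum_core [leRHS](bigID (mem D)) /= [leRHS]addrC; apply: lerD; last first.
  rewrite mulr_natl -sumr_const [leRHS](partition_big cl [pred t | leaf t]) /=.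
    rewrite [leLHS]big_mkcond [leRHS]big_mkcond; apply: ler_sum => t _.
    rewrite inE /=; case: ifP => // lt; apply: le_trans (leaf_inner lt) _.
    apply: sum_wcore_le => v /= /andP[/eqP e ne].
    by rewrite !inE e lt ne eqxx.
  by move=> v; rewrite inE => /andP[].
rewrite [leRHS]big_mkcond [leLHS]big_mkcond; apply: ler_sum => v _.
by rewrite inE /wcore; case: (v \in D); case: (v \in F).
Qed.

Definition jump n t := iter n up t.

(** The inner nodes of unbranched chains: below them there is no choice, and the step up crosses no
    long edge. *)
Definition ok s := [&& node s, s != r, ~~ long s & #|children s| == 1%N].

Lemma jumpS n t : jump n.+1 t = up (jump n t). Proof. by []. Qed.
Lemma jumpSr n t : jump n.+1 t = jump n (up t). Proof. exact: iterSr. Qed.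

Lemma ok_child s x y : ok s -> x \in children s -> y \in children s -> x = y.
Proof.
by case/and4P => _ _ _ /cards1P[z ->] /set1P -> /set1P ->.
Qed.

Lemma node_jump n t : node t -> node (jump n t).
Proof. by move=> nt; elim: n => //= n; apply: node_up. Qed.

(* Every [t] in [J] loses the stretch of the core between [t] and the node
   [jump (l t) t], together with the clusters that are met on the way, and the
   edges in [Es] are added.  Since the removed nodes have a single child,
   connectedness follows by induction on the rank once every [t] in [J] is
   linked by [Es] to a node of smaller rank. *)
Section Cut.
Variables (J : {set G}) (l : G -> nat) (k : nat) (Es : {set G * G}).
Hypothesis J_node : {in J, forall t, node t /\ t != r}.
Hypothesis l_le : {in J, forall t, (l t <= k)%N}.
Hypothesis l_ok : {in J, forall t j, (0 < j <= l t)%N -> ok (jump j t)}.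

Definition removed := [set s | [exists t in J, exists j : 'I_k.+1,
  (0 < j <= l t)%N && (s == jump j t)]].

Hypothesis J_kept : {in J, forall t, t \notin removed}.
Hypothesis Es_adj : {in Es, forall e, adj e.1 e.2 /\ Q e.1 e.2}.
Hypothesis Es_kept :
  {in Es, forall e, cl e.1 \notin removed /\ cl e.2 \notin removed}.

Definition cl_link := [rel x y | [exists e in Es,
  ((cl e.1 == x) && (cl e.2 == y)) || ((cl e.1 == y) && (cl e.2 == x))]].

Hypothesis J_link : {in J, forall t, exists s,
  [/\ node s, s \notin removed, (rk s < rk t)%N & connect cl_link t s]}.

Lemma removedP s : reflect (exists t j, [/\ t \in J, (0 < j <= l t)%N
  & s = jump j t]) (s \in removed).
Proof.
rewrite inE; apply: (iffP exists_inP) => [[t tJ /existsP[j /andP[lj /eqP ->]]]|].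
  by exists t, j.
move=> [t [j [tJ lj ->]]]; exists t => //.
have ltj : (j < k.+1)%N by have := l_le tJ; lia.
by apply/existsP; exists (Ordinal ltj); rewrite lj eqxx.
Qed.

Lemma jump_nr t j : t \in J -> (j <= l t)%N -> jump j t != r.
Proof.
case: j => [|j] tJ lj; first by have [] := J_node tJ.
by have /and4P[] := l_ok tJ (j := j.+1) lj.
Qed.

Lemma rk_jump t i j : t \in J -> (i < j <= l t)%N ->
  (rk (jump j t) < rk (jump i t))%N.
Proof.
move=> tJ; elim: j => // j IHj /andP[]; rewrite ltnS leq_eqVlt => /predU1P[->|ij] lj.
  by rewrite jumpS rk_up // jump_nr // ltnW.
apply: leq_trans (IHj _); last by rewrite ij ltnW.
by rewrite jumpS; apply: leq_trans (rk_up _) _ => //; rewrite jump_nr // ltnW.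
Qed.

Lemma jump_child t j : t \in J -> (j < l t)%N ->
  jump j t \in children (jump j.+1 t).
Proof.
move=> tJ lj; rewrite inE node_jump ?(J_node tJ).1 //.
by rewrite jump_nr // ?(ltnW lj) // jumpS eqxx.
Qed.

(** Two chains that meet can be followed down together, as removed nodes have a single child, until
    a starting point is reached; by [J_kept] no starting point lies properly inside a chain. *)
Lemma jump_inj t t' j j' : t \in J -> t' \in J -> (j <= l t)%N ->
  (j' <= l t')%N -> jump j t = jump j' t' -> t = t' /\ j = j'.
Proof.
move=> tJ tJ'; elim: j j' => [|j IHj] [|j'] //= lj lj' e.
- by case/removedP: (J_kept tJ); exists t', j'.+1; rewrite lj'.
- by case/removedP: (J_kept tJ'); exists t, j.+1; rewrite lj.
have e2 : jump j t = jump j' t'.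
  have okj : ok (jump j.+1 t) by apply: l_ok.
  apply: (ok_child okj); first exact: jump_child.
  by rewrite /jump /= e; apply: jump_child.
by have [] := IHj j' (ltnW lj) (ltnW lj') e2; move=> -> ->.
Qed.

(** The edges from these vertices to their parents are given up for [t]. The vertex [t] stays in the
    core; if [0 < l t], so does the last node [jump (l t) t], together with the edge above it. *)
Definition piece t := [set v | (v == t) || [exists j : 'I_k.+1,
  [&& (0 < j <= l t)%N, cl v == jump j t & v != jump (l t) t]]].

Lemma pieceP t v : t \in J -> reflect (v = t \/ exists j,
  [/\ (0 < j <= l t)%N, cl v = jump j t & v != jump (l t) t]) (v \in piece t).
Proof.
move=> tJ; rewrite inE; apply: (iffP orP) => [[/eqP|]|[->|]]; first by left.
- by case/existsP => j /and3P[a /eqP b c]; right; exists j.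
- by left.
move=> [j [lj e ne]]; right; apply/existsP.
have ltj : (j < k.+1)%N by have := l_le tJ; lia.
by exists (Ordinal ltj); rewrite /= lj e ne eqxx.
Qed.

Lemma piece_disj t t' v : t \in J -> t' \in J -> v \in piece t ->
  v \in piece t' -> t = t'.
Proof.
move=> tJ tJ' /(pieceP _ tJ) vt /(pieceP _ tJ') vt'.
have cJ x : x \in J -> cl x = x by move=> /J_node[/cl_node].
case: vt vt' => [->|[j [lj e ne]]] [e'|[j' [lj' e' ne']]] //.
- by rewrite cJ // in e'; case/removedP: (J_kept tJ); exists t', j'.
- by move: e; rewrite e' cJ // => e; case/removedP: (J_kept tJ'); exists t, j.
have [] // := @jump_inj t t' j j' tJ tJ'; last by rewrite -e.
  by case/andP: lj.
by case/andP: lj'.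
Qed.

Lemma dep_piece t : t \in J ->
  dep t - dep (jump (l t) t) <= \sum_(v in piece t) wcore v.
Proof.
move=> tJ; have [nt tr] := J_node tJ.
have [l0|l0] := posnP (l t).
  by rewrite l0 subrr; apply: sumr_ge0 => v _; apply: wcore_ge0.
apply: dep_chain; last by apply/pieceP => //; left.
have next x j : (0 < j <= l t)%N -> cl x = jump j t ->
    x \in piece t \/ x = jump (l t) t.
  move=> lj cx; have [|ne] := eqVneq x (jump (l t) t); first by right.
  by left; apply/pieceP => //; right; exists j.
move=> x /(pieceP _ tJ)[->|[j [lj cx ne]]] xr.
  by apply: (next _ 1%N) => //; rewrite -up_cl.
have [e|e] := cl_par xr; last by apply: (next _ j) => //; rewrite e.
have nx : node x by rewrite -e node_cl.
apply: (next _ j.+1); last by rewrite -up_cl // jumpS -cx e.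
have : j != l t by apply: contraNneq ne => ej; rewrite -ej -cx e.
by case/andP: lj => _; lia.
Qed.

Definition cut v := [exists t in J, (v != t) && (v \in piece t)].

Lemma cutP v : reflect (exists t j, [/\ t \in J, (0 < j <= l t)%N,
  cl v = jump j t & v != jump (l t) t]) (cut v).
Proof.
apply: (iffP exists_inP) => [[t tJ /andP[vt /(pieceP _ tJ)[e|]]]|].
- by rewrite e eqxx in vt.
- by move=> [j [a b c]]; exists t, j.
move=> [t [j [tJ lj cv ne]]]; exists t => //; apply/andP; split.
  apply: contraNneq (J_kept tJ) => e; apply/removedP; exists t, j; split=> //.
  by rewrite -cv e cl_node //; have [] := J_node tJ.
by apply/pieceP => //; right; exists j.
Qed.

Lemma kept_cl v : cl v \notin removed -> ~~ cut v.
Proof.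
apply: contra => /cutP[t [j [tJ lj cv _]]]; apply/removedP.
by exists t, j; rewrite cv.
Qed.

(** The cluster of a removed node is entered from below only through its single child, which lies on
    the same chain; hence what hangs directly below a cut part is the starting point of its
    chain. *)
Lemma cut_par v : v != r -> ~~ cut v -> cut (par v) -> v \in J.
Proof.
move=> vr cv /cutP[t [j [tJ lj cpv ne]]].
have [e|ne'] := eqVneq (cl (par v)) (cl v).
  case/cutP: cv; exists t, j; split=> //; first by rewrite -e.
  apply/eqP => e2; have := rk_cl (par v); rewrite e e2 cl_node.
    by rewrite -e2 leqNgt rk_par.
  by apply: node_jump; have [] := J_node tJ.
have [nv clv uv] := cl_par_neq vr ne'.
case: j lj cpv => // j lj cpv.
have ev : v = jump j t.
  apply: (ok_child (l_ok tJ lj)); first by rewrite inE nv vr uv cpv eqxx.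
  by apply: jump_child.
case: j lj cpv ev => [|j] lj cpv ev; first by rewrite ev; exact: tJ.
case/cutP: cv; exists t, j.+1; split=> //; first exact: ltnW.
  by rewrite clv.
have lt : (rk (jump (l t) t) < rk (jump j.+1 t))%N.
  by apply: rk_jump => //; rewrite leqnn andbT; case/andP: lj.
by apply: contraTneq lt => <-; rewrite ev ltnn.
Qed.

(** An end of an added edge may lie outside the core, and then its path to the core has to join.
    This costs at most [u] per end, hence the [2 * u] in [cut_improves]. *)
Definition routes := [set x | (x \notin F) &&
  [exists e in Es, fconnect par e.1 x || fconnect par e.2 x]].

Definition core' := [set v in F | ~~ cut v] :|: routes.

Lemma fconnect_noncore a x : fconnect par a x -> x \notin F ->
  a \notin F /\ cl a = cl x.
Proof.
move=> /iter_findex <-; move: (findex _ _ _) => n.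
elim: n a => [|n IHn] a //; rewrite iterSr => xF.
have [pF ca] := IHn _ xF.
have aF : a \notin F by apply: contra pF; apply: upF.
split=> //; rewrite -ca; have [|_ -> //] := @cl_par_id a.
by apply: contraNneq aF => <-; apply: cl_core.
Qed.

Lemma routesP x : x \in routes -> cl x \notin removed /\ x \notin F.
Proof.
rewrite inE => /andP[xF /exists_inP[e /Es_kept[e1 e2]]].
by case/orP => /fconnect_noncore/(_ xF) [_ <-].
Qed.

Lemma core'_kept v : v \in F -> cl v \notin removed -> v \in core'.
Proof. by move=> vF cv; rewrite !inE vF kept_cl. Qed.

Lemma core'_end e x : e \in Es -> x = e.1 \/ x = e.2 ->
  x \in core' /\ cl x \notin removed.
Proof.
move=> eE xe; have cx : cl x \notin removed.
  by have [e1 e2] := Es_kept eE; case: xe => ->.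
have [xF|xF] := boolP (x \in F); first by rewrite core'_kept.
split=> //; rewrite in_setU; apply/orP; right; rewrite inE xF; apply/exists_inP.
by exists e => //; case: xe => ->; rewrite connect0 ?orbT.
Qed.

(** The vertices whose old parent edge stays available; those of [J] lose theirs. *)
Definition moved := [set v in core' | (v \notin J) && (v != r)].

Lemma moved_par v : v \in moved -> par v \in core'.
Proof.
rewrite inE => /and3P[vX vJ vr]; move: vX; rewrite in_setU => /orP[|vR].
  rewrite inE => /andP[vF cv]; rewrite !inE upF //=.
  by apply/orP; left; apply: contra vJ; apply: cut_par.
have [cv vF] := routesP vR.
have cpv : cl (par v) = cl v.
  by have [|] := @cl_par_id v => //; apply: contraNneq vF => <-; apply: cl_core.
have [pF|pF] := boolP (par v \in F); first by rewrite core'_kept // cpv.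
rewrite in_setU; apply/orP; right; rewrite inE pF /=.
move: vR; rewrite inE vF /= => /exists_inP[e eE ve]; apply/exists_inP; exists e => //.
have fp : fconnect par v (par v) by apply: fconnect1.
by case/orP: ve => ve; rewrite (connect_trans ve fp) ?orbT.
Qed.

Definition edges' := [set (v, par v) | v in moved] :|: Es.

Lemma edges'P e : e \in edges' -> [/\ e.1 \in core', e.2 \in core' & adj e.1 e.2]
  /\ Q e.1 e.2.
Proof.
move=> /setUP[/imsetP[v vM ->]|eE] /=.
  have vr : v != r by move: vM; rewrite inE => /and3P[].
  split; last exact: Q_par; split; [|exact: moved_par|exact: adj_par].
  by move: vM; rewrite inE => /andP[].
have [a q] := Es_adj eE; split=> //; split=> //.
  by have [] := core'_end eE (or_introl erefl).
by have [] := core'_end eE (or_intror erefl).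
Qed.

Local Notation con := (connect (link edges')).

Lemma con_sym x y : con x y = con y x.
Proof. by apply: sym_connect_sym => a b /=; rewrite orbC. Qed.

Lemma con_moved v : v \in moved -> con v (par v).
Proof.
move=> vM; apply: connect1 => /=; apply/orP; left; apply/setUP; left.
by apply/imsetP; exists v.
Qed.

Lemma con_cl v : v \in core' -> cl v \notin removed -> con v (cl v).
Proof.
elim/(par_ind rp): v => [|v vr IH] vX cv; first by rewrite cl_r.
have [e|ne] := eqVneq (cl v) v; first by rewrite e.
have [_ e _] := cl_par_id ne.
have vM : v \in moved.
  rewrite inE vX vr andbT; apply: contra ne => /J_node[nv _].
  by rewrite cl_node.
apply: connect_trans (con_moved vM) _; rewrite -e; apply: IH.
  exact: moved_par.
by rewrite e.
Qed.

Lemma con_cl_link x y : connect cl_link x y -> con x y.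
Proof.
apply: connect_sub => {x y}.
have E e : e \in Es -> con (cl e.1) (cl e.2).
  move=> eE; have [a1 b1] := core'_end eE (or_introl erefl).
  have [a2 b2] := core'_end eE (or_intror erefl).
  rewrite con_sym in b1 *; rewrite con_sym; apply: connect_trans (con_cl a2 b2).
  apply: connect_trans (_ : con e.1 e.2); first by rewrite con_sym con_cl.
  by apply: connect1 => /=; apply/orP; left; apply/setUP; right; case: (e) eE.
move=> x y /exists_inP[e /E ce] /orP[]/andP[/eqP <- /eqP <-] //.
by rewrite con_sym.
Qed.

Lemma con_root v : v \in core' -> con r v.
Proof.
have main x : x \in F -> ~~ cut x -> con x r.
  have [n] := ubnP (rk x); elim: n x => // n IHn x ltn xF cx.
  have [->//|xr] := eqVneq x r; have [xJ|xJ] := boolP (x \in J).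
    have [s [ns sR lt xs]] := J_link xJ.
    apply: connect_trans (con_cl_link xs) _; apply: IHn; first by lia.
      exact: node_core.
    by apply: kept_cl; rewrite cl_node.
  have xM : x \in moved by rewrite !inE xF cx xJ xr.
  apply: connect_trans (con_moved xM) _.
  have lt := rk_par xr; apply: IHn; [by lia|exact: upF|].
  by apply: contra xJ; apply: cut_par.
rewrite con_sym => vX; move: (vX); rewrite in_setU => /orP[|vR].
  by rewrite inE => /andP[]; apply: main.
have [cv _] := routesP vR; apply: connect_trans (con_cl vX cv) _.
by apply: main; [exact: cl_core|apply: kept_cl; rewrite cl_cl].
Qed.

Lemma cut_r : ~~ cut r.
Proof.
apply/cutP => -[t [j [tJ /andP[_ lj] e _]]].
by have := jump_nr tJ lj; rewrite -e cl_r eqxx.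
Qed.

(** At most [4 * u] leads to the node of the cluster and, if that node is removed, at most [2 * u]
    is spent on each further step up its chain, as far as [jump (l t) t]. *)
Lemma core'_covered : covered w r par core' ((4 + 2 * k)%:R * u).
Proof.
move=> v; have [n nv pn] := reach_cl v; have /andP[_ dv] := depth_cl v.
have [cR|cR] := boolP (cl v \in removed); last first.
  exists n; first by rewrite nv core'_kept ?cl_core ?cl_cl.
  rewrite pn; apply: le_trans dv _; rewrite ler_pM2r // ler_nat; lia.
have /removedP[t [j [tJ lj ec]]] := cR.
have zX : jump (l t) t \in core'.
  have nz : node (jump (l t) t) by apply: node_jump; have [] := J_node tJ.
  rewrite !inE node_core //=; apply/orP; left.
  apply/cutP => -[t' [j' [tJ' /andP[_ lj'] e ne]]].
  rewrite cl_node // in e; have [et ej] := jump_inj tJ tJ' (leqnn _) lj' e.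
  by move: ne; rewrite et eqxx.
suff [m mz pm] : exists2 m, iter m par (jump j t) = jump (l t) t &
    plen w r par m (jump j t) <= (2 * (l t - j))%:R * u.
  exists (n + m)%N; first by rewrite addnC iterD nv ec mz.
  rewrite plen_cat nv ec pn.
  apply: le_trans (lerD dv pm) _; rewrite -mulrDl ler_pM2r // -natrD ler_nat.
  by have := l_le tJ; lia.
case/andP: lj => j0 ltj.
have [d ld] : exists d, l t = (j + d)%N by exists (l t - j)%N; rewrite subnKC.
rewrite ld addKn -ld {ltj}; elim: d j j0 ld {ec} => [|d IHd] j j0 ld.
  by exists 0%N; rewrite /= ?mul0r // ld addn0.
have lj : (0 < j <= l t)%N by rewrite j0 ld leq_addr.
have /and4P[nj jr nl _] := l_ok tJ lj.
have [n1 e1 p1] := reach_up nj jr nl.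
have [||n2 e2 p2] := IHd j.+1 => //; first by rewrite ld addSnnS.
exists (n2 + n1)%N; first by rewrite iterD e1 -jumpS.
rewrite addnC plen_cat e1 -jumpS mulnS natrD mulrDl.
exact: lerD.
Qed.

Lemma sum_route a :
  \sum_(x | (x \notin F) && fconnect par a x) wp x <= hang a.
Proof.
elim/(par_ind rp): a => [|a ar IH].
  rewrite hangF // big_pred0 // => x; have [//|xF] := boolP (x \in F).
  by apply/negP => /fconnect_noncore/(_ xF) []; rewrite rF.
have [aF|aF] := boolP (a \in F).
  rewrite hangF // big_pred0 // => x; have [//|xF] := boolP (x \in F).
  by apply/negP => /fconnect_noncore/(_ xF) []; rewrite aF.
rewrite hangNF // (bigD1 a) /=; last by rewrite aF connect0.
rewrite addrC lerD2r; apply: le_trans IH.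
rewrite [leRHS]big_mkcond [leLHS]big_mkcond; apply: ler_sum => x _.
case: ifP => [/andP[/andP[-> ax] xa]|_]; last by case: ifP => // _; apply: wp_ge0.
rewrite /= ifT // -(iter_findex ax).
case: findex (iter_findex ax) => [/= e|n e]; first by rewrite e eqxx in xa.
by rewrite iterSr fconnect_iter.
Qed.

Lemma sum_routes : \sum_(x in routes) wp x <= \sum_(e in Es) 2 * u.
Proof.
apply: (@le_trans _ _ (\sum_(e in Es) (hang e.1 + hang e.2))); last first.
  by apply: ler_sum => e _; have := hang_le e.1; have := hang_le e.2; lra.
pose f a x : R := if (x \notin F) && fconnect par a x then wp x else 0.
apply: (@le_trans _ _ (\sum_(e in Es) \sum_x (f e.1 x + f e.2 x))); last first.
  apply: ler_sum => e _; rewrite big_split /=.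
  by apply: lerD; rewrite -big_mkcond /=; apply: sum_route.
have f_ge0 a x : 0 <= f a x by rewrite /f; case: ifP => // _; apply: wp_ge0.
rewrite exchange_big /= big_mkcond; apply: ler_sum => x _.
case: ifP => [|_]; last by apply: sumr_ge0 => e _; rewrite addr_ge0.
rewrite inE => /andP[xF /exists_inP[e eE ex]].
rewrite (bigD1 e) //= -[leLHS]addr0; apply: lerD.
  have le y : 0 <= y -> wp x <= wp x + y by move=> y0; rewrite lerDl.
  by case/orP: ex => ex; rewrite /f ex xF /= ?[_ + wp x]addrC; apply: le;
     case: ifP => // _; apply: wp_ge0.
by apply: sumr_ge0 => e' _; rewrite addr_ge0.
Qed.

Lemma sum_pieces : \sum_(t in J) (dep t - dep (jump (l t) t)) <=
  \sum_(v | cut v || (v \in J)) wcore v.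
Proof.
apply: (@le_trans _ _ (\sum_(t in J) \sum_(v in piece t) wcore v)).
  by apply: ler_sum => t; apply: dep_piece.
have -> : \sum_(t in J) \sum_(v in piece t) wcore v =
          \sum_v \sum_(t in J | v \in piece t) wcore v.
  by rewrite (exchange_big_dep predT).
rewrite [leRHS]big_mkcond; apply: ler_sum => v _.
have [/exists_inP[t tJ vt]|/exists_inPn none] :=
  boolP [exists t in J, v \in piece t]; last first.
  rewrite big_pred0 => [|t]; first by case: ifP => // _; apply: wcore_ge0.
  by apply/negP => /andP[/none /negP].
rewrite (bigD1 t) ?tJ //= big_pred0 => [|t'].
  rewrite addr0 ifT //; have [->|ne] := eqVneq v t; first by rewrite tJ orbT.
  by apply/orP; left; apply/exists_inP; exists t => //; rewrite ne.
apply/negP => /andP[/andP[tJ' vt']].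
by rewrite (piece_disj tJ' tJ vt' vt) eqxx.
Qed.

Lemma sum_edges' : \sum_(e in edges') w e.1 e.2 <=
  \sum_(v in moved) wp v + \sum_(e in Es) w e.1 e.2.
Proof.
have -> : \sum_(v in moved) wp v =
    \sum_(e in [set (v, par v) | v in moved]) w e.1 e.2.
  rewrite big_imset /=; last by move=> x y _ _ [].
  apply: eq_bigr => v; rewrite inE => /and3P[_ _ vr].
  by rewrite /wpar (negbTE vr).
rewrite 3!(big_mkcond (fun e => e \in _)) -big_split /=; apply: ler_sum => e _.
have [eE|] := boolP (e \in edges'); last first.
  by rewrite inE negb_or => /andP[/negbTE -> /negbTE ->]; rewrite addr0.
have [[_ _ /(w_ge0 ew) w0] _] := edges'P eE.
by move: eE; rewrite inE; case: (e \in _); case: (e \in _) => //= _; lra.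
Qed.

Lemma sum_moved : \sum_(v in moved) wp v <=
  \sum_(v | ~~ (cut v || (v \in J))) wcore v + \sum_(x in routes) wp x.
Proof.
rewrite [leLHS]big_mkcond [X in _ <= X + _]big_mkcond.
rewrite [X in _ <= _ + X]big_mkcond -big_split /=; apply: ler_sum => v _.
have h1 := wp_ge0 v; have h2 := wcore_ge0 v.
case: ifP => [|_]; last by do 2!case: ifP => _; lra.
rewrite inE => /and3P[vX vJ _]; move: vX; rewrite in_setU.
have [vR _|vR] := boolP (v \in routes); first by case: ifP => _; lra.
rewrite orbF inE => /andP[vF cv]; rewrite (negbTE cv) (negbTE vJ) /= addr0.
by rewrite /wcore vF.
Qed.

Lemma cut_improves : improves (4 + 2 * k)
  (\sum_(t in J) (dep t - dep (jump (l t) t)) -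
   \sum_(e in Es) (w e.1 e.2 + 2 * u)).
Proof.
have rX : r \in core' by rewrite !inE rF cut_r.
have EX : {in edges', forall e, [/\ e.1 \in core', e.2 \in core' & adj e.1 e.2]}.
  by move=> e /edges'P[].
have [par' [rk' [rp' pX' cov' sum' par'E]]] :=
  rebuild ew rp rX EX con_root core'_covered.
exists par', rk', core'; split=> //.
  rewrite sum_core [leRHS](bigID (fun v => cut v || (v \in J))) /=.
  rewrite [X in _ + (_ - X)]big_split /=.
  have := sum_edges'; have := sum_moved; have := sum_routes.
  by have := sum_pieces; lra.
move=> v vr; have av : adj v (par' v) by have [_ _ H] := rp'; have [] := H v vr.
have [->|/orP[/edges'P[]|/edges'P[_ /= q]]] := par'E v vr; first exact: Q_par.
  by [].
by apply: Q_sym => //; rewrite adj_sym.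
Qed.

End Cut.

Lemma rk_jump_le n t : (rk (jump n t) <= rk t)%N.
Proof.
elim: n => //= n IHn; have [e|ne] := eqVneq (jump n t) r.
  by rewrite e up_r -e.
exact: leq_trans (ltnW (rk_up ne)) IHn.
Qed.

Lemma rk_jump_lt n t : t != r -> (0 < n)%N -> (rk (jump n t) < rk t)%N.
Proof.
by case: n => // n tr _; rewrite jumpSr; apply: leq_ltn_trans (rk_jump_le _ _) (rk_up tr).
Qed.

(** * Counting the nodes that do not start a long unbranched chain *)

Definition good k t := [&& node t, t != r, ~~ long t
  & [forall j : 'I_k, ok (jump j.+1 t)]].

Lemma goodP k t : reflect [/\ node t, t != r, ~~ long t
  & forall j, (0 < j <= k)%N -> ok (jump j t)] (good k t).
Proof.
apply: (iffP and4P) => -[a b c d]; split=> //.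
  by move=> [|j] //= lj; have /forallP/(_ (Ordinal lj)) := d.
by apply/forallP => j; apply: d; rewrite /= ltn_ord.
Qed.

Lemma ok_jump_inj j t t' : node t -> t != r -> node t' -> t' != r ->
  (forall i, (0 < i <= j)%N -> ok (jump i t)) ->
  (forall i, (0 < i <= j)%N -> ok (jump i t')) ->
  jump j t = jump j t' -> t = t'.
Proof.
elim: j t t' => [|j IHj] t t' nt tr nt' tr' okt okt' //; rewrite !jumpSr => e.
have e2 : up t = up t'.
  have /and4P[n1 r1 _ _] := okt 1%N isT; have /and4P[n2 r2 _ _] := okt' 1%N isT.
  by apply: IHj => // i /andP[i0 li]; rewrite -jumpSr; [apply: okt|apply: okt'].
apply: (ok_child (okt 1%N isT)); rewrite inE ?nt ?tr /= ?eqxx //.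
by rewrite nt' tr' /= e2 eqxx.
Qed.

Definition longs := [set v in F | u < wp v].
Definition leaves := [set t | leaf t].
Definition bad k := [set t | node t && ~~ good k t].
Definition stuck j := [set t | [&& node t, t != r, ~~ ok (jump j.+1 t)
  & [forall i : 'I_j, ok (jump i.+1 t)]]].

(** One step up maps [stuck j.+1] into [stuck j], injectively because the node reached has a single
    child. *)
Lemma card_stuck j : (#|stuck j| <= #|stuck 0|)%N.
Proof.
elim: j => // j IHj; apply: leq_trans IHj.
have inj : {in stuck j.+1 &, injective up}.
  move=> t t'; rewrite !inE => /and4P[nt tr _ /forallP h] /and4P[nt' tr' _ /forallP h'] e.
  apply: (@ok_child (up t)); first exact: (h ord0).
    by rewrite inE nt tr /= eqxx.
  by rewrite inE nt' tr' e /= eqxx.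
rewrite -(card_in_imset inj); apply/subset_leq_card/subsetP => s /imsetP[t].
rewrite !inE => /and4P[nt tr h1 /forallP h2] ->.
have /and4P[n1 r1 _ _] : ok (up t) := h2 ord0.
rewrite n1 r1 -jumpSr h1 /=; apply/forallP => i.
by rewrite -jumpSr; have := h2 (lift ord0 i).
Qed.

Lemma sum_children :
  (\sum_(s | node s) #|children s| + 1 = #|[set s | node s]|)%N.
Proof.
rewrite [RHS](cardsD1 r) inE node_r addnC; congr (_ + _)%N.
rewrite -[RHS]sum1_card [RHS](partition_big up node) /=; last first.
  by move=> t; rewrite !inE => /andP[_ /node_up].
apply: eq_bigr => s ns; rewrite -[LHS]sum1_card; apply: eq_bigl => t.
by rewrite !inE andbA [in RHS](andbC (t != r)).
Qed.

(* The number of nodes with at least two children, with multiplicity, is bounded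
   by the number of childless ones. *)
Lemma card_stuck0 : (#|stuck 0| <= 2 * #|leaves| + 3 * #|longs|.+1)%N.
Proof.
have -> : #|stuck 0| = (\sum_(s | node s) (~~ ok s) * #|children s|)%N.
  rewrite -[LHS]sum1_card [LHS](partition_big up node) /=; last first.
    by move=> t; rewrite !inE => /andP[/node_up].
  apply: eq_bigr => s ns; have [os|os] /= := boolP (ok s).
    rewrite mul0n big_pred0 // => t; rewrite !inE; apply/negP.
    by move=> /andP[/and4P[_ _ h _] /eqP e]; move: h; rewrite /jump /= e os.
  rewrite mul1n -sum1_card; apply: eq_bigl => t; rewrite !inE /jump /=.
  have [->|_] := eqVneq (up t) s; last by rewrite !andbF.
  rewrite os !andbT; congr (_ && _); rewrite andb_idr // => _.
  by apply/forallP => -[].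
pose sp s := (s == r) || long s.
pose nch s := children s == set0.
(* A node with one child fails to be [ok] only through [sp], and [c + 2 <= 2 * c] for [c >= 2]
   children. As there are fewer children than nodes by [sum_children], the summands [2] on the left
   outweigh the doubled numbers of children on the right. *)
have h0 : (\sum_(s | node s) ((~~ ok s) * #|children s| + 2) <=
  \sum_(s | node s) (#|children s| + #|children s| + (nch s + nch s) + sp s))%N.
  apply: leq_sum => s ns; rewrite /nch /sp /ok ns /=.
  have [->|] := eqVneq (children s) set0; first by rewrite cards0 muln0.
  rewrite -card_gt0; case: #|children s| => [//|[|c]] _.
    by case: (s == r) => //=; case: (long s).
  by rewrite andbF /=; lia.
have nch_le : (\sum_(s | node s) nch s <= #|leaves| + \sum_(s | node s) sp s)%N.
  rewrite -sum1_card (big_mkcond (mem leaves)) (big_mkcond node).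
  rewrite [X in (_ <= _ + X)%N]big_mkcond -big_split; apply: leq_sum => s _ /=.
  rewrite inE /leaf /nch /sp; case: (node s) => //=.
  by case: (s == r); case: (long s); case: (_ == set0).
have sp_le : (\sum_(s | node s) sp s <= #|longs|.+1)%N.
  have -> : #|longs|.+1 = #|r |: longs|.
    by rewrite cardsU1 inE /wpar eqxx (lt_gtF u_gt0) andbF.
  rewrite -sum1_card big_mkcond [leqRHS]big_mkcond; apply: leq_sum => s _ /=.
  rewrite !inE /sp; case: (node s) => //; case: eqVneq => //= sr.
  by rewrite /long sr /=; case: (_ && _).
move: h0; rewrite !big_split /= sum_nat_const.
have := sum_children; rewrite cardsE; move: nch_le sp_le.
move: (\sum_(s | node s) sp s)%N (\sum_(s | node s) nch s)%N => a b.
move: (\sum_(s | node s) #|children s|)%N => c; move: (\sum_(s | _) _)%N => d.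
clear; lia.
Qed.

(** A bad node is the root, or long, or stuck at some step below [k], and stuck nodes are for every
    step at most as many as in [stuck 0]. *)
Lemma card_bad k :
  (#|bad k| <= #|longs|.+1 + k * (2 * #|leaves| + 3 * #|longs|.+1))%N.
Proof.
elim: k => [|k IHk].
  rewrite mul0n addn0; apply: leq_trans (_ : #|r |: longs| <= _)%N; last first.
    by rewrite (leq_trans (leq_card_setU _ _)) // cards1.
  apply/subset_leq_card/subsetP => t; rewrite !inE => /andP[nt].
  have [//|tr] := eqVneq t r; rewrite /good nt tr /=.
  rewrite negb_and negbK => /orP[/and3P[_ -> ->] //|/negP[]].
  by apply/forallP => -[].
rewrite mulSnr addnA; apply: leq_trans (leq_add IHk (leq_trans (card_stuck k) card_stuck0)).
apply: leq_trans (leq_card_setU _ _); apply/subset_leq_card/subsetP => t.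
rewrite in_setU !inE => /andP[nt ng]; rewrite nt /=.
have [gk|] := boolP (good k t) => //=; case/goodP: (gk) => _ tr nl h.
rewrite tr /=; apply/andP; split.
  apply: contra ng => okk; apply/goodP; split=> // j /andP[j0].
  by rewrite leq_eqVlt => /predU1P[-> //|lj]; apply: h; rewrite j0.
by apply/forallP => i; apply: (h i.+1); rewrite /= ltn_ord.
Qed.

(** For each [j] there is at most one such [t], since its chain can be followed down from [s]
    without a choice. *)
Lemma card_above k (X : {set G}) s : {in X, forall t, good k t} ->
  (#|[set t in X | [exists j : 'I_k, jump j.+1 t == s]]| <= k)%N.
Proof.
move=> Xg; case: k Xg => [|k] Xg.
  rewrite leqn0 cards_eq0; apply/eqP/setP => t; rewrite !inE.
  by apply/negP => /andP[_ /existsP[[]]].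
set A := [set _ | _].
pose f t : 'I_k.+1 := odflt ord0 [pick j : 'I_k.+1 | jump j.+1 t == s].
have fA t : t \in A -> jump (f t).+1 t = s.
  rewrite inE /f => /andP[_ /existsP[j jt]]; case: pickP => [i /eqP //|/(_ j)].
  by rewrite jt.
have inj : {in A &, injective f}.
  move=> t t' tA tA' e; have := fA t tA; rewrite e -(fA t' tA').
  have tX x : x \in A -> good k.+1 x by rewrite inE => /andP[/Xg].
  have /goodP[nt tr _ h] := tX t tA; have /goodP[nt' tr' _ h'] := tX t' tA'.
  apply: ok_jump_inj => // i /andP[i0 li]; [apply: h|apply: h'];
    by rewrite i0 (leq_trans li).
by rewrite -(card_in_imset inj) -[leqRHS]card_ord max_card.
Qed.

(* A node is met by at most [k] chains of length [k] starting at good nodes, so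
   the conflict relation has bounded out-degree. *)
Lemma select k (X : {set G}) (tgt : G -> G) : {in X, forall t, good k t} ->
  exists2 I : {set G}, I \subset X & (#|X| <= (4 * k).+1 * #|I|)%N /\
    {in I &, forall t t', t != t' -> forall j, (0 < j <= k)%N ->
      jump j t' != t /\ jump j t' != tgt t}.
Proof.
move=> Xg; pose e x y := [exists j : 'I_k,
  (jump j.+1 y == x) || (jump j.+1 y == tgt x)].
have out : {in X, forall x, #|[set y in X | e x y]| <= 2 * k}%N.
  move=> x xX; rewrite mul2n -addnn.
  apply: leq_trans (leq_add (card_above x Xg) (card_above (tgt x) Xg)).
  apply: leq_trans (leq_card_setU _ _); apply/subset_leq_card/subsetP => y.
  rewrite in_setU !inE => /andP[-> /existsP[j /orP[]jy]]; apply/orP.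
    by left; apply/existsP; exists j.
  by right; apply/existsP; exists j.
have [I sI [iI cI]] := indep_set out; exists I => //.
rewrite mulnA in cI; split=> // t t' tI tI' ne j /andP[j0 lj].
case: j j0 lj => // j _ lj.
have := iI t t' tI tI' ne; rewrite negb_exists => /forallP/(_ (Ordinal lj)) /=.
by rewrite negb_or => /andP[].
Qed.

Lemma improves_le kappa s s' : s' <= s -> improves kappa s -> improves kappa s'.
Proof.
move=> ss [par' [rk' [F' [st le q]]]]; exists par', rk', F'; split=> //.
by apply: le_trans le; rewrite lerD2l.
Qed.

Lemma improves_leq kappa kappa' s : (kappa <= kappa')%N ->
  improves kappa s -> improves kappa' s.
Proof.
move=> kk [par' [rk' [F' [[a b c cov'] le q]]]]; exists par', rk', F'; split=> //.
split=> // v; have [n nF pn] := cov' v; exists n => //; apply: le_trans pn _.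
by rewrite ler_pM2r // ler_nat.
Qed.

Lemma dep_jump k t j : good k t -> (j <= k)%N ->
  j%:R * u <= dep t - dep (jump j t).
Proof.
case/goodP => nt tr _ okt; elim: j => [|j IHj] lj; first by rewrite mul0r subrr.
have jr : jump j t != r.
  by case: j {IHj} lj => // j lj; have /and4P[] := okt j.+1 (ltnW lj).
have := IHj (ltnW lj); have := dep_up (node_jump j nt) jr.
by rewrite -jumpS -natr1; lra.
Qed.

Lemma wconn_jump k t j : good k t -> (j <= k.+1)%N ->
  wconn w light t (jump j t) (dep t - dep (jump j t)).
Proof.
case/goodP => nt tr nl okt; elim: j => [|j IHj] lj.
  by rewrite subrr; apply: wconn_refl.
have [jr jl] : jump j t != r /\ ~~ long (jump j t).
  by case: j {IHj} lj => // j lj; have /and4P[] := okt j.+1 lj.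
have h1 := IHj (ltnW lj); have h2 := wconn_up (node_jump j nt) jr jl.
by apply: wconn_le (wconn_trans h1 h2); rewrite -jumpS; lra.
Qed.

(** * The edges of one scale against the core *)

Section Level.
Variables (H : sgraph) (delta : R) (K : nat) (B : {set G * G}).
Hypothesis H_free : minor_free H G.
Hypothesis delta_gt0 : 0 < delta.
Hypothesis K_big : 26 <= delta * K%:R.
Hypothesis B_adj : {in B, forall e, adj e.1 e.2 /\ Q e.1 e.2}.
Hypothesis B_w : {in B, forall e, K%:R * u < 2 * w e.1 e.2 /\ w e.1 e.2 <= K%:R * u}.
Hypothesis B_stretch : {in B, forall e s,
  wconn w light e.1 e.2 s -> (1 + delta) * w e.1 e.2 < s}.
Hypothesis B_apart : {in B &, forall e f, e != f ->
  (wconn w light e.1 f.1 (8 * u) -> ~ wconn w light e.2 f.2 (8 * u)) /\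
  (wconn w light e.1 f.2 (8 * u) -> ~ wconn w light e.2 f.1 (8 * u))}.

(** A chain of [k] steps has length at least [K * u + 3 * u], which covers an edge of weight at most
    [K * u], the [2 * u] for its routes, and a gain of [u]. *)
Let k := (K + 3)%N.

Lemma wconn_cl4 v : wconn w light v (cl v) (4 * u).
Proof.
by apply: wconn_le (wconn_cl v); have /andP[] := depth_cl v.
Qed.

Lemma wconn_same x y : cl x = cl y -> wconn w light x y (8 * u).
Proof.
move=> e; have := wconn_light_sym (wconn_cl4 y); rewrite -e => h.
by apply: wconn_le (wconn_trans (wconn_cl4 x) h); lra.
Qed.

(** In [improves_down] 13 splits into 8 for two clusters, 2 for the step from the last removed node
    to the target, 2 for the routes and 1 for the gain. The 26 is its double, as [w] exceeds only
    half of [K * u]. *)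
Lemma stretch_w e : e \in B -> w e.1 e.2 + 13 * u < (1 + delta) * w e.1 e.2.
Proof.
move=> /B_w[h _]; have h2 : delta * (K%:R * u) < delta * (2 * w e.1 e.2).
  by rewrite ltr_pM2l.
have h3 : 26 * u <= delta * K%:R * u by rewrite ler_pM2r.
by lra.
Qed.

Lemma B_cl e : e \in B -> cl e.1 != cl e.2.
Proof.
move=> eB; apply/eqP => /wconn_same/(B_stretch eB); have := stretch_w eB.
by have := w_ge0 ew (B_adj eB).1; move: u_gt0; lra.
Qed.

Lemma cl_link_neq x y : cl_link B x y -> x != y.
Proof.
case/exists_inP => e /B_cl ne; case/orP => /andP[/eqP <- /eqP <-] //.
by rewrite eq_sym.
Qed.

Lemma cl_link_sym x y : cl_link B x y = cl_link B y x.
Proof. by rewrite /=; apply: eq_existsb => e; rewrite orbC. Qed.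

Lemma cl_link_node x y : cl_link B x y -> node x /\ node y.
Proof.
by case/exists_inP => e _; case/orP => /andP[/eqP <- /eqP <-]; rewrite !node_cl.
Qed.

Lemma link_choice (P : G -> G -> bool) (X : {set G}) :
  {in X, forall t, exists s, cl_link B t s && P t s} ->
  exists (pe : G -> G * G) (tgt : G -> G), {in X, forall t, [/\ pe t \in B,
    (cl (pe t).1 = t /\ cl (pe t).2 = tgt t) \/
    (cl (pe t).1 = tgt t /\ cl (pe t).2 = t) & P t (tgt t)]}.
Proof.
move=> XP; have pick t : exists p : (G * G) * G, t \in X -> [/\ p.1 \in B,
    (cl p.1.1 = t /\ cl p.1.2 = p.2) \/ (cl p.1.1 = p.2 /\ cl p.1.2 = t)
    & P t p.2].
  have [tX|tX] := boolP (t \in X); last by exists ((t, t), t).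
  have [s /andP[/exists_inP[e eB ce] ps]] := XP t tX.
  exists (e, s) => _; split=> //=.
  by case/orP: ce => /andP[/eqP -> /eqP ->]; [left|right].
have [f fP] := fin_all_exists pick.
by exists (fun t => (f t).1), (fun t => (f t).2) => t /fP.
Qed.

Lemma sum_imset_le (I : {set G}) (f : G -> G * G) (h : G * G -> R) :
  {in I, forall t, 0 <= h (f t)} ->
  \sum_(e in [set f t | t in I]) h e <= \sum_(t in I) h (f t).
Proof.
move=> h0; rewrite [leRHS](partition_big f [in f @: I]) /=; last first.
  by move=> t tI; apply: imset_f.
apply: ler_sum => e /imsetP[t tI ->].
rewrite (bigD1 t) ?tI ?eqxx //= lerDl; apply: sumr_ge0 => s.
by case/andP=> /andP[sI _] _; apply: h0.
Qed.

(* The up-link of [t] is replaced by an edge of [B] to a node of smaller rank.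
   If that node lies on the chain above [t], only the stretch below it is
   removed, which is long enough by [B_stretch]. *)
Lemma improves_down (X : {set G}) :
  {in X, forall t, good k t /\ exists s, cl_link B t s && (rk s < rk t)%N} ->
  exists n, (#|X| <= (4 * k).+1 * n)%N /\ improves (4 + 2 * k) (n%:R * u).
Proof.
move=> XP; have Xg : {in X, forall t, good k t} by move=> t /XP[].
have [|pe [tgt pt]] := @link_choice (fun t s => (rk s < rk t)%N) X.
  by move=> t /XP[].
have [I sI [cI sel]] := select tgt Xg; exists #|I|; split=> //.
have IX t : t \in I -> t \in X by apply/subsetP.
(* If the target lies on the chain, the removed stretch ends one node below it; otherwise [find]
   returns [k], the whole chain. *)
pose l t := find (fun j => jump j.+1 t == tgt t) (iota 0 k).
have lk t : (l t <= k)%N.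
  by rewrite -[leqRHS](size_iota 0); apply: find_size.
have l_before t j : (0 < j <= l t)%N -> jump j t != tgt t.
  case: j => // j /andP[_ lj].
  have := before_find 0%N lj; rewrite nth_iota ?add0n => [->//|].
  exact: leq_trans lj (lk t).
have l_found t : (l t < k)%N -> jump (l t).+1 t = tgt t.
  rewrite -{1}(size_iota 0 k) -has_find => hk.
  have := nth_find 0%N hk; rewrite nth_iota ?add0n => [/eqP //|].
  by rewrite has_find size_iota in hk.
have node_I t : t \in I -> node t /\ t != r.
  by move=> /IX/Xg/goodP[].
have okI t : t \in I -> forall j, (0 < j <= l t)%N -> ok (jump j t).
  move=> /IX/Xg/goodP[_ _ _ h] j /andP[j0 lj]; apply: h.
  by rewrite j0 (leq_trans lj).
pose Rm := removed I l k.
have RmP := removedP (fun t _ => lk t : l t <= k)%N.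
have I_kept t : t \in I -> t \notin Rm.
  move=> tI; apply/negP => /RmP[t' [j [tI' /andP[j0 lj] e]]].
  have [et|ne] := eqVneq t t'.
    have := rk_jump_lt (node_I t tI).2 j0.
    by rewrite {1}et -e ltnn.
  have [|/eqP []] := sel t t' tI tI' ne j; last by [].
  by rewrite j0 (leq_trans lj).
have tgt_kept t : t \in I -> tgt t \notin Rm.
  move=> tI; apply/negP => /RmP[t' [j [tI' /andP[j0 lj] e]]].
  have [et|ne] := eqVneq t t'.
    by have := l_before t' j; rewrite j0 lj -e et eqxx => /(_ isT).
  have [|_ /eqP []] := sel t t' tI tI' ne j; last by [].
  by rewrite j0 (leq_trans lj).
have := @cut_improves I l k [set pe t | t in I] node_I (fun t _ => lk t) okI I_kept.
have Es_B e : e \in [set pe t | t in I] -> e \in B.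
  by case/imsetP => t /IX/pt[h _ _] ->.
case.
- by move=> e /Es_B/B_adj.
- move=> e /imsetP[t tI ->]; have [_ h _] := pt t (IX t tI).
  by case: h => -[-> ->]; split; first [exact: I_kept | exact: tgt_kept].
- move=> t tI; exists (tgt t); have [h1 h2 h3] := pt t (IX t tI); split=> //.
  + by case: h2 => -[]; [move=> _ <-|move=> <- _]; apply: node_cl.
  + exact: tgt_kept.
  + apply: connect1; apply/exists_inP; exists (pe t); first exact: imset_f.
    by case: h2 => -[-> ->]; rewrite !eqxx ?orbT.
move=> par' [rk' [F' [st le q]]]; exists par', rk', F'; split=> //.
apply: le_trans le; rewrite lerD2l.
have sE := @sum_imset_le I pe (fun e => w e.1 e.2 + 2 * u).
apply: (@le_trans _ _ (\sum_(t in I) (dep t - dep (jump (l t) t)) -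
   \sum_(t in I) (w (pe t).1 (pe t).2 + 2 * u))); last first.
  rewrite lerD2l lerN2; apply: sE => t tI; have [h1 _ _] := pt t (IX t tI).
  by have := w_ge0 ew (B_adj h1).1; move: u_gt0; lra.
rewrite -sumrB mulr_natl -sumr_const; apply: ler_sum => t tI.
have [h1 h2 _] := pt t (IX t tI); have gt := Xg t (IX t tI).
have [_ wK] := B_w h1; have := lk t; rewrite leq_eqVlt => /predU1P[lt|lt].
  have := dep_jump gt (leqnn k); rewrite {1}/k natrD lt; lra.
have cj := wconn_jump gt (leqW lt).
rewrite (l_found t lt) in cj.
have : wconn w light (pe t).1 (pe t).2 (4 * u + (dep t - dep (tgt t)) + 4 * u).
  have c1 := wconn_cl4 (pe t).1; have c2 := wconn_light_sym (wconn_cl4 (pe t).2).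
  case: h2 => -[e1 e2]; rewrite e1 e2 in c1 c2.
    exact: wconn_trans (wconn_trans c1 cj) c2.
  exact: wconn_trans (wconn_trans c1 (wconn_light_sym cj)) c2.
move=> /(B_stretch h1); have := stretch_w h1.
have /goodP[nt tr nl okt] := gt.
have [jr jl] : jump (l t) t != r /\ ~~ long (jump (l t) t).
  case: (l t) lt => // j lj; have /and4P[] // := okt j.+1 (ltnW lj).
have := dep_up_lt (node_top (node_jump (l t) nt)) jr jl.
by rewrite -jumpS (l_found t lt); lra.
Qed.

(* Among the nodes with the same target, the one of smallest rank keeps its
   up-link, and the others are linked to it through the target. *)
Lemma improves_up (X T : {set G}) :
  {in X, forall t, good k t /\
     exists s, cl_link B t s && ((rk t < rk s)%N && (s \in T))} ->
  exists n, (#|X| <= (4 * k).+1 * n)%N /\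
    improves (4 + 2 * k) ((n%:R - (k * #|T|)%:R) * u).
Proof.
move=> XP; have Xg : {in X, forall t, good k t} by move=> t /XP[].
have [|pe [tgt pt]] :=
    @link_choice (fun t s => (rk t < rk s)%N && (s \in T)) X.
  by move=> t /XP[].
have [I sI [cI sel]] := select tgt Xg; exists #|I|; split=> //.
have IX t : t \in I -> t \in X by apply/subsetP.
pose J := [set t in I | [exists t0 in I, (tgt t0 == tgt t) && (rk t0 < rk t)%N]].
have JI t : t \in J -> t \in I by rewrite inE => /andP[].
have node_I t : t \in I -> node t /\ t != r by move=> /IX/Xg/goodP[].
have node_J t : t \in J -> node t /\ t != r by move=> /JI/node_I.
have okJ t : t \in J -> forall j, (0 < j <= k)%N -> ok (jump j t).
  by move=> /JI/IX/Xg/goodP[].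
have lk t : t \in J -> (k <= k)%N by [].
pose Rm := removed J (fun=> k) k.
have RmP := removedP lk.
have I_kept t : t \in I -> t \notin Rm.
  move=> tI; apply/negP => /RmP[t' [j [tJ' jk e]]].
  have [et|ne] := eqVneq t t'.
    have /andP[j0 _] := jk; have := rk_jump_lt (node_I t tI).2 j0.
    by rewrite {1}et -e ltnn.
  by have [/eqP []] := sel t t' tI (JI t' tJ') ne j jk.
have tgt_kept t : t \in I -> tgt t \notin Rm.
  move=> tI; apply/negP => /RmP[t' [j [tJ' jk e]]].
  have [et|ne] := eqVneq t t'.
    have [_ _ /andP[lt _]] := pt t (IX t tI).
    by have := rk_jump_le j t'; rewrite -e -et leqNgt lt.
  by have [_ /eqP []] := sel t t' tI (JI t' tJ') ne j jk.
have J_kept t : t \in J -> t \notin Rm by move=> /JI/I_kept.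
have link_tgt t : t \in I -> cl_link [set pe t | t in I] t (tgt t).
  move=> tI; have [h1 h2 h3] := pt t (IX t tI).
  apply/exists_inP; exists (pe t); first exact: imset_f.
  by case: h2 => -[-> ->]; rewrite !eqxx ?orbT.
have := @cut_improves J (fun=> k) k [set pe t | t in I] node_J lk okJ J_kept.
have Es_B e : e \in [set pe t | t in I] -> e \in B.
  by case/imsetP => t /IX/pt[h _ _] ->.
case.
- by move=> e /Es_B/B_adj.
- move=> e /imsetP[t tI ->]; have [_ h _] := pt t (IX t tI).
  by case: h => -[-> ->]; split; first [exact: I_kept | exact: tgt_kept].
- move=> t tJ; have tI := JI t tJ; move: (tJ).
  rewrite inE => /andP[_ /exists_inP[t0 t0I /andP[/eqP e0 lt0]]].
  exists t0; split=> //; [by have [] := node_I t0 t0I|exact: I_kept|].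
  apply: connect_trans (connect1 (link_tgt t tI)) _; rewrite -e0.
  apply: connect1; have /exists_inP[e eE ce] := link_tgt t0 t0I.
  by apply/exists_inP; exists e => //; rewrite orbC.
move=> par' [rk' [F' [st le q]]]; exists par', rk', F'; split=> //.
apply: le_trans le; rewrite lerD2l.
(* Distinct nodes of [I] outside [J] have distinct targets, because ranks are injective. *)
have cardJ : (#|I| <= #|J| + #|T|)%N.
  rewrite -(cardsID J I); apply: leq_add.
    by apply/subset_leq_card; apply: subsetIr.
  have inj : {in I :\: J &, injective tgt}.
    move=> t t' /setDP[tI tJ] /setDP[tI' tJ'] e; apply/eqP.
    have [_ irk _] := rp; rewrite -(inj_eq irk) eqn_leq.
    apply/andP; split; rewrite leqNgt.
      apply: contra tJ => lt; rewrite inE tI; apply/exists_inP; exists t' => //.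
      by rewrite e eqxx.
    apply: contra tJ' => lt; rewrite inE tI'; apply/exists_inP; exists t => //.
    by rewrite e eqxx.
  rewrite -(card_in_imset inj); apply/subset_leq_card/subsetP => s.
  by case/imsetP => t /setDP[tI _] ->; have [_ _ /andP[]] := pt t (IX t tI).
have sE := @sum_imset_le I pe (fun e => w e.1 e.2 + 2 * u).
(* Each element of [J] gains [k = K + 3], each element of [I] costs at most [K + 2]; with [cardJ]
   this leaves [#|I| - k * #|T|]. *)
apply: (@le_trans _ _ ((#|J| * k)%:R * u - (#|I| * (K + 2))%:R * u)).
  rewrite -mulrBl ler_pM2r // lerBlDr addrAC lerBrDr -!natrD ler_nat.
  by rewrite /k; move: cardJ; clear; nia.
apply: lerB.
  rewrite natrM -mulrA [leLHS]mulr_natl -sumr_const; apply: ler_sum => t tJ.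
  exact: dep_jump (Xg t (IX t (JI t tJ))) (leqnn k).
apply: le_trans (sE _) _.
  move=> t tI; have [h1 _ _] := pt t (IX t tI).
  by have := w_ge0 ew (B_adj h1).1; move: u_gt0; lra.
rewrite natrM -mulrA [leRHS]mulr_natl -sumr_const; apply: ler_sum => t tI.
by have [/B_w[_ h1] _ _] := pt t (IX t tI); rewrite natrD; lra.
Qed.

Definition linked := [set t | [exists s, cl_link B t s]].

Lemma card_B : (#|B| <= 2 ^ #|H| * #|linked|)%N.
Proof.
have [->|[e0 e0B]] := set_0Vmem B; first by rewrite cards0.
pose C t := [set v | cl v == t].
pose P := [set C t | t in linked].
have linkedP e : e \in B -> cl e.1 \in linked /\ cl e.2 \in linked.
  move=> eB; rewrite !inE; split; apply/existsP; [exists (cl e.2)|exists (cl e.1)];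
    by apply/exists_inP; exists e; rewrite ?eqxx ?orbT.
have C_inj t t' : node t -> C t = C t' -> t = t'.
  by move=> nt /setP/(_ t); rewrite !inE cl_node // eqxx => /esym/eqP.
have fP : branch_family P.
  split=> [A /imsetP[t tL ->]|A A' /imsetP[t tL ->] /imsetP[t' tL' ->] ne].
    have [nt _] : node t /\ true.
      by move: tL; rewrite inE => /existsP[s /cl_link_node[]].
    split; first by apply/set0Pn; exists t; rewrite inE cl_node.
    set rel := [rel a b | _].
    have rs : connect_sym rel.
      by apply: sym_connect_sym => a b /=; rewrite andbCA adj_sym.
    have ct v : cl v = t -> connect rel v t.
      elim/(par_ind rp): v => [|v vr IH] cv; first by rewrite -cv cl_r.
      have [<-|ne] := eqVneq v t; first exact: connect0.
      have [|_ cp _] := @cl_par_id v; first by rewrite cv eq_sym.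
      apply: connect_trans (IH _); last by rewrite cp.
      by apply: connect1; rewrite /= !inE cp cv eqxx adj_par.
    move=> x y; rewrite !inE => /eqP cx /eqP cy.
    by apply: connect_trans (ct x cx) _; rewrite rs ct.
  rewrite -setI_eq0; apply/eqP/setP => v; rewrite !inE.
  by apply: contraNF ne => /andP[/eqP <- /eqP <-].
have P0 : P != set0.
  by apply/set0Pn; exists (C (cl e0.1)); apply: imset_f; have [] := linkedP e0 e0B.
have : (#|B| <= npairs P)%N.
  pose f (e : G * G) := (C (cl e.1), C (cl e.2)).
  have inj : {in B &, injective f}.
    move=> e e' eB eB' [/(C_inj _ _ (node_cl _)) c1 /(C_inj _ _ (node_cl _)) c2].
    apply/eqP; apply/negPn/negP => ne; have [h _] := B_apart eB eB' ne.
    by apply: h; apply: wconn_same.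
  rewrite -(card_in_imset inj) /npairs.
  have -> : (\sum_(A in P) #|nb P A| = \sum_(A in P) \sum_(A' in nb P A) 1)%N.
    by apply: eq_bigr => A _; rewrite sum1_card.
  rewrite pair_big_dep /= sum1dep_card; apply/subset_leq_card/subsetP => p.
  case/imsetP => e eB ->; have [l1 l2] := linkedP e eB.
  rewrite !inE /= !imset_f //= andbC; apply/andP; split.
    apply/touchP; exists e.1, e.2; rewrite !inE; split=> //.
    by have [] := B_adj eB.
  by apply: contra (B_cl eB) => /eqP/(C_inj _ _ (node_cl _)) ->.
move=> le; apply: leq_trans le _.
have /ltnW le : (npairs P < 2 ^ #|H| * #|P|)%N.
  by rewrite ltnNge; apply/negP => /(dense_minor fP P0).
by apply: leq_trans le _; rewrite leq_mul2l leq_imset_card orbT.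
Qed.

(** The factors compare [B] with the linked nodes, these with the set [T] of the next proof, and [T]
    with the gain and the long edges. *)
Definition level_const : nat :=
  2 ^ #|H| * ((2 * k * (4 * k).+1).+1 * (4 * (4 * k).+1)).

(* [T] collects the good nodes with a [B]-neighbour of smaller rank and the bad
   nodes; every other linked node has all its [B]-neighbours in [T]. *)
Lemma level_improves : exists n,
  (#|B| <= level_const * (n + #|longs|.+1))%N /\
  improves (4 + 2 * k) (n%:R * u / 2).
Proof.
pose D := [set t in linked | good k t &&
  [exists s, cl_link B t s && (rk s < rk t)%N]].
pose N2 := [set t in linked | good k t && (t \notin D)].
pose T := D :|: bad k.
have cL : (#|linked| <= #|T| + #|N2|)%N.
  apply: leq_trans (leq_card_setU _ _); apply/subset_leq_card/subsetP => t tL.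
  have nt : node t by move: (tL); rewrite inE => /existsP[s /cl_link_node[]].
  move: (tL); rewrite !in_setU !in_set => ->; rewrite nt /=.
  by case: (good k t) => //=; rewrite ?orbT // orbF; case: [exists _, _].
have cT : (#|T| <= #|D| + #|bad k|)%N by apply: leq_card_setU.
have N2P : {in N2, forall t, good k t /\
    exists s, cl_link B t s && ((rk t < rk s)%N && (s \in T))}.
  move=> t; rewrite inE => /and3P[tL gt tD]; split=> //.
  move: (tL); rewrite inE => /existsP[s ts]; exists s; rewrite ts /=.
  have lt : (rk t < rk s)%N.
    rewrite ltn_neqAle leqNgt; have [_ irk _] := rp.
    rewrite (inj_eq irk) (cl_link_neq ts) /=; apply: contra tD => lt.
    by rewrite inE tL gt; apply/existsP; exists s; rewrite ts.
  rewrite lt in_setU inE; have [_ ns] := cl_link_node ts.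
  have st : cl_link B s t by rewrite cl_link_sym.
  have sL : s \in linked by rewrite inE; apply/existsP; exists t; exact: st.
  rewrite sL [s \in bad k]inE ns /=; case: (good k s) => //=.
  by rewrite orbF; apply/existsP; exists t; rewrite lt andbT; exact: st.
have DP : {in D, forall t, good k t /\
    exists s, cl_link B t s && (rk s < rk t)%N}.
  by move=> t; rewrite inE => /and3P[_ gt /existsP h].
have half n : n%:R * u / 2 <= n%:R * u.
  by have : 0 <= n%:R * u by [rewrite mulr_ge0 ?ler0n // ltW]; lra.
have := card_B; rewrite /level_const.
set c := (4 * k).+1; set c2 := (2 * k * c).+1; set sg := (2 ^ #|H|)%N.
have bnd n m : (m <= c2 * (4 * c) * n -> #|B| <= sg * m ->
    #|B| <= sg * (c2 * (4 * c)) * n)%N.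
  move=> h1 h2; apply: leq_trans h2 _; rewrite -mulnA.
  by rewrite leq_mul2l h1 orbT.
(* If [N2] is this large, the loss [k * #|T|] in [improves_up] is at most half of [n], hence the
   division by 2 in the statement. Otherwise [T] bounds the linked nodes. *)
move=> hB; have [big|small] := leqP (2 * k * c * #|T|) #|N2|.
  have [n [cN imp]] := improves_up N2P; rewrite -/c in cN.
  have kT : (2 * (k * #|T|) <= n)%N.
    rewrite -(@leq_pmul2l c) //; apply: leq_trans cN.
    by apply: leq_trans big; move: #|T| => m; clear; lia.
  exists n; split; last first.
    apply: improves_le imp; rewrite mulrAC ler_pM2r //.
    have : (2 * (k * #|T|))%:R <= n%:R :> R by rewrite ler_nat.
    by rewrite natrM; lra.
  apply: bnd hB; apply: leq_trans cL _.
  have k1 : (0 < k)%N by rewrite /k addnS.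
  have TN : (#|T| <= #|N2|)%N.
    by apply: leq_trans big; rewrite leq_pmull // !muln_gt0 k1.
  apply: (@leq_trans (2 * (c * n))); first by move: TN cN; clear; lia.
  rewrite mulnA; apply: leq_mul; last exact: leq_addr.
  rewrite mulnA leq_mul2r; apply/orP; right.
  by rewrite (@leq_trans (1 * 4)) // leq_mul2r.
have cL2 : (#|linked| <= c2 * #|T|)%N.
  by apply: leq_trans cL _; rewrite /c2 mulSn leq_add2l ltnW.
(* The larger part of [T] decides; if bad nodes prevail, there are many leaves or many long
   edges. *)
have [Db|bD] := leqP #|bad k| #|D|.
  have [n [cD imp]] := improves_down DP; rewrite -/c in cD.
  exists n; split; last exact: improves_le (half n) imp.
  apply: bnd hB; apply: leq_trans cL2 _; rewrite -mulnA leq_mul2l; apply/orP; right.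
  by move: cT Db cD; clear; nia.
exists #|leaves|; split; last first.
  apply: improves_le (half _) _; apply: improves_leq leaf_improves.
  exact: leq_addr.
apply: bnd hB; apply: leq_trans cL2 _; rewrite -mulnA leq_mul2l; apply/orP; right.
by have := card_bad k; move: cT bD; rewrite /c; clear; nia.
Qed.

End Level.
End Clusters.

(** * The edges charged by a run *)

Section Blocking.
Variables (R : realType) (G : sgraph) (w : G -> G -> R) (delta : R).
Hypothesis ew : edge_weighting w.
Hypothesis delta_gt0 : 0 < delta.
Implicit Types (S : {set G}) (x y v : G) (p q h : seq G) (ch : seq (G * G)).

Lemma walk_suffix x y p : path adj y p -> x \in y :: p -> uniq (y :: p) ->
  exists q, [/\ path adj x q, last x q = last y p, uniq (x :: q),
    {subset q <= p} & walk_length w x q <= walk_length w y p].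
Proof.
elim: p y => [|z p IHp] y.
  move=> _; rewrite inE => /eqP -> _; exists [::]; split=> //.
move=> pp xp uq; have [xy|ne] := eqVneq x y.
  by rewrite xy; exists (z :: p); split=> // a.
move: pp xp uq; rewrite inE (negbTE ne) => /= /andP[yz pz] xz /andP[_ uz].
have [q [pq lq uq sq wq]] := IHp z pz xz uz; exists q; split=> //.
  by move=> a /sq ap; rewrite inE ap orbT.
by have := w_ge0 ew yz; lra.
Qed.

Lemma walk_uniq x p : path adj x p -> exists q,
  [/\ path adj x q, last x q = last x p, uniq (x :: q), {subset q <= p}
    & walk_length w x q <= walk_length w x p].
Proof.
elim: p x => [|y p IHp] x; first by exists [::].
move=> /= /andP[xy /IHp[q [pq lq uq sq wq]]].
have [xq|xq] := boolP (x \in y :: q).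
  have [s [ps ls us ss ws]] := walk_suffix pq xq uq.
  exists s; split=> //; rewrite ?ls //.
    by move=> a /ss/sq ap; rewrite inE ap orbT.
  by have := w_ge0 ew xy; lra.
exists (y :: q); split; first by rewrite /= xy.
- by rewrite /= lq.
- by rewrite cons_uniq xq.
- by move=> z; rewrite !inE => /orP[-> //|/sq ->]; apply: orbT.
- by rewrite /= lerD2l.
Qed.

(** Simple paths have bounded size, so they can be coded in a finite type, over which the minimum is
    taken. *)
Lemma shortest_path_exists S x y p : internally_explored_path S x y p ->
  exists2 q, shortest_path w S x y q & walk_length w x q <= walk_length w x p.
Proof.
move=> iep; pose N := #|G|.
pose T := {n : 'I_N.+1 & n.-tuple G}.
have small q : internally_explored_path S x y q -> (size q < N.+1)%N.
  case=> _ _ uq _; rewrite ltnS ltnW // -[X in (X <= _)%N]/(size (x :: q)).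
  by rewrite -(card_uniqP uq) max_card.
pose mk q (s : (size q < N.+1)%N) : T :=
  @Tagged _ (Ordinal s) (fun n : 'I_N.+1 => n.-tuple G) (in_tuple q).
pose P (t : T) := `[< internally_explored_path S x y (tagged t) >].
have P0 : P (mk p (small p iep)) by apply/asboolP.
case: (arg_minP (fun t : T => walk_length w x (tagged t)) P0) => t /asboolP tP tmin.
exists (tagged t); last exact: (tmin (mk p (small p iep)) P0).
split=> // q qP; apply: (tmin (mk q (small q qP))); exact/asboolP.
Qed.

Lemma iep_sub S S' x y p : S \subset S' ->
  internally_explored_path S x y p -> internally_explored_path S' x y p.
Proof.
move=> /subsetP sS [a b c d]; split=> // z zp zx zy; apply: sS; exact: d.
Qed.

Lemma rev_walk x p : rev (x :: p) = last x p :: rev (belast x p).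
Proof. by rewrite lastI rev_rcons. Qed.

Lemma iep_rev S x y p : internally_explored_path S x y p ->
  internally_explored_path S y x (rev (belast x p)) /\
  walk_length w y (rev (belast x p)) = walk_length w x p.
Proof.
move=> [pp lp up ip]; split; last by rewrite -lp walk_length_rev.
split.
- rewrite -lp rev_path; apply: sub_path pp => a b; by rewrite adj_sym.
- by case: p {pp up ip} lp => //= z p _; rewrite rev_cons last_rcons.
- by rewrite -lp -rev_walk rev_uniq.
move=> z; rewrite -lp -rev_walk mem_rev => zp zy zx.
by apply: ip => //; rewrite -lp.
Qed.

Lemma first_unexplored S (e : rel G) y q : path e y q -> y \in S ->
  last y q \notin S -> exists q1 b q2, [/\ q = q1 ++ b :: q2,
    {subset y :: q1 <= S} & b \notin S].
Proof.
elim: q y => [|z q IHq] y /=; first by move=> _ ->.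
move=> /andP[_ pq] yS lS; have [zS|zS] := boolP (z \in S).
  have [q1 [b [q2 [-> sq bS]]]] := IHq z pq zS lS.
  exists (z :: q1), b, q2; split=> // a; rewrite inE => /predU1P[-> //|].
  exact: sq.
by exists [::], z, q; split=> // a; rewrite inE => /eqP ->.
Qed.

Definition lighter S (e : G * G) : rel G :=
  [rel a b | (w a b < w e.1 e.2) || (a \in S) && (b \in S)].

(** The first edge of the walk that leaves [S] is a boundary edge and must be lighter than [e]. Were
    the walk short, its explored beginning would show that this edge blocks [e]. *)
Lemma unblocked_stretch S e s : boundary S e -> ~ blocked w delta S e ->
  wconn w (lighter S e) e.1 e.2 s -> (1 + delta) * w e.1 e.2 < s.
Proof.
move=> [ae e1 e2] ub [q [pq lq wq]]; rewrite ltNge; apply/negP => les; apply: ub.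
have [|q1 [b [q2 [eq sq bS]]]] := first_unexplored pq e1; first by rewrite lq.
move: pq wq; rewrite eq cat_path /= => /and3P[pq1 /andP[ab lt] pq2] wq.
set a := last e.1 q1 in ab lt.
have aS : a \in S by apply: sq; apply: mem_last.
have {}lt : w a b < w e.1 e.2.
  by move: lt; rewrite /lighter /= (negbTE bS) andbF orbF.
have subadj x p : path [rel a b | adj a b && lighter S e a b] x p -> path adj x p.
  by apply: sub_path => c d /andP[].
exists (a, b); split=> //.
have pb : path adj e.1 (rcons q1 b) by rewrite rcons_path (subadj _ _ pq1).
have [p [pp lp up sp wp]] := walk_uniq pb; rewrite last_rcons in lp.
have ip : internally_explored_path S e.1 b p.
  split=> // z; rewrite inE => /predU1P[-> //|/sp]; rewrite mem_rcons inE.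
  move=> /predU1P[->|zq _ _]; first by rewrite eqxx.
  by apply: sq; rewrite inE zq orbT.
have [p' sp' wp'] := shortest_path_exists ip; exists p' => //.
apply: le_trans wp' _; apply: le_trans wp _; apply: le_trans les.
apply: le_trans wq; rewrite -cats1 !walk_length_cat /= addr0 lerD2l lerDl.
by apply: (walk_length_ge0 ew); apply: subadj pq2.
Qed.

(* [ch] lists the edges along which new vertices are reached after the history
   [h], in chronological order. *)
Fixpoint charged h ch : Prop :=
  if ch is e :: ch' then
    [/\ boundary (explored h) e, ~ blocked w delta (explored h) e
      & charged (rcons h e.2) ch']
  else True.

Lemma charged_cat h c1 c2 :
  charged h (c1 ++ c2) <-> charged h c1 /\ charged (h ++ map snd c1) c2.
Proof.
elim: c1 h => [|e c1 IH] h /=; first by rewrite cats0; split=> [|[]].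
rewrite -cat_rcons; split=> [[a b /IH[c d]]|[[a b c] d]] //; split=> //.
by apply/IH.
Qed.

(** A round costs at most [(1 + delta) * w y x] on the way to [y], then [w y x], and both once more
    on the way back, where the reversed route is available. *)
Lemma call_charged h v h' t : v \in h -> blocking_call w delta h v h' t ->
  exists ch, [/\ charged h ch, h' = h ++ map snd ch, last v t = v
    & walk_length w v t <= (4 + 2 * delta) * \sum_(e <- ch) w e.1 e.2].
Proof.
move=> + call; elim: call => {h v h' t} [h v _|h v y x p h1 t1 q h2 t2 el sp c1 IH1 sq c2 IH2] vh.
  by exists [::]; rewrite /= cats0 big_nil mulr0.
have [[/= ayx yS xS] ub via] := el.
have [|ch1 [cc1 eh1 lt1 wt1]] := IH1; first by rewrite mem_rcons inE eqxx.
have vh1 : v \in h1 by rewrite eh1 mem_cat mem_rcons inE vh orbT.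
have [ch2 [cc2 eh2 lt2 wt2]] := IH2 vh1.
have w0 := w_ge0 ew ayx.
have [[pp lp up ip] pmin] := sp; have [[pq lq uq iq] qmin] := sq.
have hS : v \in explored h by rewrite inE.
have wp : walk_length w v p <= (1 + delta) * w y x.
  (* Either the agent stands at [y], or the edge was blocked by one ending in [v]; the short path
     that witnessed this, reversed, is still internally explored. *)
  case: via => [/= yv|[k [z [_ [_ _ _ [p0 [ip0 _] wp0]]]]]].
    have -> : p = [::].
      case: (p) lp up => // a p' /= lp /andP[/negP[]].
      by rewrite -yv -lp mem_last.
    by rewrite /= mulr_ge0 // addr_ge0 // ltW.
  have [ip1 wp1] := iep_rev ip0; rewrite /= in wp0 wp1.
  apply: le_trans (pmin _ (iep_sub _ ip1)) _; last by rewrite wp1.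
  by apply/subsetP => a; rewrite !inE; apply: mem_take.
have sS : {subset v :: p <= explored h}.
  move=> a ap; have [-> //|av] := eqVneq a v; have [-> //|ay] := eqVneq a y.
  exact: ip.
have wq : walk_length w x q <= w y x + walk_length w v p.
  have [[pr lr ur ir] wr] := iep_rev (And4 pp lp up ip).
  have er : y :: rev (belast v p) = rev (v :: p) by rewrite rev_walk lp.
  have := qmin (y :: rev (belast v p)); rewrite /= wr (w_sym ew ayx).
  apply; split; first by rewrite /= adj_sym ayx.
  - exact: lr.
  - by rewrite er cons_uniq rev_uniq up andbT mem_rev; apply: contra xS; apply: sS.
  move=> a; rewrite er inE mem_rev => /predU1P[-> /eqP //|ap _ _].
  have := sS a ap; rewrite !inE => ah.
  by rewrite eh1 mem_cat mem_rcons inE ah !orbT.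
exists ((y, x) :: ch1 ++ ch2); split.
- by split=> //; apply/charged_cat; split=> //; rewrite -eh1.
- by rewrite eh2 eh1 /= map_cat -cat_rcons catA.
- by rewrite last_cat /= last_cat lt1 last_cat lq.
rewrite walk_length_cat lp /= walk_length_cat lt1 walk_length_cat lq.
by rewrite big_cons big_cat /=; lra.
Qed.

End Blocking.

(** * Stretch and mutual separation of the charged edges *)

Section Charged.
Variables (R : realType) (G : sgraph) (w : G -> G -> R) (delta : R).
Hypothesis ew : edge_weighting w.
Hypothesis delta_gt0 : 0 < delta.
Implicit Types (S : {set G}) (h : seq G) (ch : seq (G * G)).

Lemma charged_at h c1 e c2 : charged w delta h (c1 ++ e :: c2) ->
  boundary (explored (h ++ map snd c1)) e /\
  ~ blocked w delta (explored (h ++ map snd c1)) e.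
Proof. by case/charged_cat => _ []. Qed.

Lemma charged_uniq h ch : charged w delta h ch -> uniq ch.
Proof.
suff main : charged w delta h ch ->
    {in ch, forall e, e.2 \notin h} /\ uniq ch by move=> /main [].
elim: ch h => [|e ch IH] h //= [[_ _ e2] _ /IH[c2 uc]]; split.
  move=> f; rewrite inE => /predU1P[->|/c2]; first by move: e2; rewrite inE.
  by rewrite mem_rcons inE negb_or => /andP[].
rewrite uc andbT; apply/negP => /c2.
by rewrite mem_rcons inE eqxx.
Qed.

Lemma charged_adj h ch e : charged w delta h ch -> e \in ch -> adj e.1 e.2.
Proof. by move=> + ec; case/splitPr: ec => c1 c2 /charged_at[[]]. Qed.

Lemma charged_stretch h ch e s : charged w delta h ch -> e \in ch ->
  wconn w [rel a b | w a b < w e.1 e.2] e.1 e.2 s -> (1 + delta) * w e.1 e.2 < s.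
Proof.
move=> + ec; case/splitPr: ec => c1 c2 /charged_at[be ub] wc.
apply: (unblocked_stretch ew be ub); apply: wconn_sub wc => a b _ /= lt.
by rewrite /lighter /= lt.
Qed.

(* Otherwise a detour through [g'] would contradict [unblocked_stretch]. *)
Lemma unblocked_apart S g g' u : boundary S g -> ~ blocked w delta S g ->
  adj g'.1 g'.2 -> lighter w S g g'.1 g'.2 -> w g'.1 g'.2 <= w g.1 g.2 ->
  16 * u <= delta * w g.1 g.2 -> u < w g.1 g.2 ->
  (wconn w (light w u) g.1 g'.1 (8 * u) ->
     ~ wconn w (light w u) g'.2 g.2 (8 * u)) /\
  (wconn w (light w u) g.1 g'.2 (8 * u) ->
     ~ wconn w (light w u) g'.1 g.2 (8 * u)).
Proof.
move=> bg ub ag' lg' le d16 ltu.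
have sub x y l : wconn w (light w u) x y l -> wconn w (lighter w S g) x y l.
  apply: wconn_sub => a b _; rewrite /light /lighter /= => le'.
  by rewrite (le_lt_trans le').
have c12 : wconn w (lighter w S g) g'.1 g'.2 (w g'.1 g'.2) by apply: wconn_step.
have c21 : wconn w (lighter w S g) g'.2 g'.1 (w g'.1 g'.2).
  rewrite (w_sym ew ag'); apply: wconn_step; rewrite 1?adj_sym //.
  move: lg'; rewrite /lighter /= (w_sym ew ag') => /orP[-> //|/andP[-> ->]].
  exact: orbT.
split=> /sub h1 /sub h2.
  have := unblocked_stretch ew bg ub (wconn_trans (wconn_trans h1 c12) h2); lra.
have := unblocked_stretch ew bg ub (wconn_trans (wconn_trans h1 c21) h2); lra.
Qed.

(** Let [a] be charged before [b]. If [b] is lighter, it may serve in a walk between the ends of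
    [a]; if not, [a] lies inside the explored set when [b] is charged and may serve in a walk
    between the ends of [b]. Two detours of [8 * u] make [16 * u]. *)
Lemma charged_apart h ch e f u : charged w delta h ch -> e \in ch -> f \in ch ->
  e != f -> 16 * u <= delta * w e.1 e.2 -> 16 * u <= delta * w f.1 f.2 ->
  u < w e.1 e.2 -> u < w f.1 f.2 ->
  (wconn w (light w u) e.1 f.1 (8 * u) ->
     ~ wconn w (light w u) e.2 f.2 (8 * u)) /\
  (wconn w (light w u) e.1 f.2 (8 * u) ->
     ~ wconn w (light w u) e.2 f.1 (8 * u)).
Proof.
have sym := wconn_light_sym ew.
have main c1 c2 c3 a b : charged w delta h (c1 ++ a :: c2 ++ b :: c3) ->
  16 * u <= delta * w a.1 a.2 -> 16 * u <= delta * w b.1 b.2 ->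
  u < w a.1 a.2 -> u < w b.1 b.2 ->
  (wconn w (light w u) a.1 b.1 (8 * u) ->
     ~ wconn w (light w u) a.2 b.2 (8 * u)) /\
  (wconn w (light w u) a.1 b.2 (8 * u) ->
     ~ wconn w (light w u) a.2 b.1 (8 * u)).
  move=> cc da db ua ub; have [ba uba] := charged_at cc.
  have [bb ubb] : boundary (explored (h ++ map snd (c1 ++ a :: c2))) b /\
      ~ blocked w delta (explored (h ++ map snd (c1 ++ a :: c2))) b.
    by apply: (@charged_at _ _ _ c3); rewrite -catA.
  have [lt|le] := ltP (w b.1 b.2) (w a.1 a.2).
    have [|h1 h2] := @unblocked_apart _ a b u ba uba (let: And3 x _ _ := bb in x)
      _ (ltW lt) da ua; first by rewrite /lighter /= lt.
    by split=> [c|c] /sym; [apply: h1|apply: h2].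
  have [|h1 h2] := @unblocked_apart _ b a u bb ubb (let: And3 x _ _ := ba in x)
      _ le db ub.
    have [_ a1 _] := ba; rewrite /lighter /=; apply/orP; right; move: a1.
    rewrite !inE map_cat catA ![_ \in (h ++ _) ++ _]mem_cat /= mem_head orbT andbT.
    by move=> ->.
  by split=> [/sym c|c] d; [apply: h1 c d|apply: (h2 _ c); apply: sym].
move=> cc ec fc ef de df ue uf; case/splitPr: ec cc fc => c1 c2 cc.
rewrite mem_cat inE eq_sym (negbTE ef) /= => /orP[fc|fc].
  case/splitPr: fc cc => c3 c4; rewrite -catA /= => cc.
  have [h1 h2] := main _ _ _ _ _ cc df de uf ue.
  by split=> /sym c /sym d; [apply: h1 c d|apply: h2 d c].
by case/splitPr: fc cc => c3 c4 cc; apply: main cc _ _ _ _.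
Qed.

End Charged.

(** * Tours and the spanning trees inside them *)

Section Tours.
Variables (R : realType) (G : sgraph) (w : G -> G -> R).
Hypothesis ew : edge_weighting w.

Lemma walk_length_zip x p :
  walk_length w x p = \sum_(e <- zip (x :: p) p) w e.1 e.2.
Proof.
elim: p x => [|y p IHp] x; first by rewrite big_nil.
by rewrite [LHS]/= IHp [zip _ _]/= big_cons.
Qed.

Lemma tour_tree x p : tour x p -> exists par rk,
  rooted x par rk /\ \sum_v wpar w x par v <= walk_length w x p.
Proof.
case=> pp _ all_p; pose E := [set e | e \in zip (x :: p) p].
have adjE : {in zip (x :: p) p, forall e, adj e.1 e.2}.
  move=> e; elim: p x pp {all_p E} => //= y p IHp x /andP[xy pp].
  by rewrite inE => /predU1P[-> //|]; apply: IHp.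
have pE : path (link E) x p.
  have : {subset zip (x :: p) p <= E} by move=> e; rewrite inE.
  elim: p x {pp all_p adjE} E => //= y p IHp x E sE.
  rewrite (sE (x, y)) ?inE ?eqxx //=; apply: IHp => e ep; apply: sE.
  by rewrite inE ep orbT.
have EX : {in E, forall e, [/\ e.1 \in [set: G], e.2 \in [set: G] & adj e.1 e.2]}.
  by move=> e; rewrite !inE => /adjE.
have [|par [rk [pr irk pX _ sum]]] := grow_tree ew (in_setT x) EX.
  by move=> v _; apply: (path_connect pE); apply: all_p.
exists par, rk; split.
  split=> // [a b|v vx]; first by apply: irk; rewrite inE.
  have [_ l lt] := pX v (in_setT v) vx; split=> //.
  by case/orP: l => /EX[] //=; rewrite adj_sym.
rewrite walk_length_zip; apply: (@le_trans _ _ (\sum_(e in E) w e.1 e.2)).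
  apply: le_trans sum; rewrite [leLHS](eq_bigl (mem [set: G])) // => v.
  by rewrite !inE.
rewrite (eq_bigl (mem (undup (zip (x :: p) p)))) => [|e]; last first.
  by rewrite inE /= mem_undup.
rewrite -big_uniq ?undup_uniq //=; move: (zip _ _) adjE => s.
elim: s => //= e s IHs adjE; rewrite big_cons.
have ae : 0 <= w e.1 e.2 by apply: (w_ge0 ew); apply: adjE; rewrite inE eqxx.
have {}IHs := IHs (fun f fs => adjE f (@mem_behead _ (e :: s) f fs)).
by case: ifP => _; rewrite ?big_cons ?lerD2l //; lra.
Qed.

Lemma tour_exists (s : G) : connected_graph G -> exists x p, @tour G x p.
Proof.
case=> _ conn; exists s.
have route (a b : G) : exists2 p, path adj a p & last a p = b.
  have /connectP[p pp lp] := conn a b (in_setT a) (in_setT b).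
  by exists p => //; apply: sub_path pp => x y /and3P[].
suff [p [pp lp sp]] : exists p, [/\ path adj s p, last s p = s
    & {subset enum G <= s :: p}].
  by exists p; split=> // z; apply: sp; rewrite mem_enum.
elim: (enum G) => [|z l [p [pp lp sp]]]; first by exists [::].
have [p1 pp1 lp1] := route s z; have [p2 pp2 lp2] := route z s.
exists (p ++ p1 ++ p2); split.
- by rewrite !cat_path lp lp1 pp pp1.
- by rewrite !last_cat lp lp1.
move=> a; rewrite inE => /predU1P[->|/sp].
  by rewrite catA -cat_cons mem_cat -lp1 -[in X in last X p1]lp -last_cat mem_last.
by rewrite -cat_cons mem_cat => ->.
Qed.

Lemma opt_ge (s : G) (a c : R) : connected_graph G -> 0 < c ->
  (forall x p, @tour G x p -> a <= c * walk_length w x p) -> a <= c * opt w.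
Proof.
move=> conn c0 bnd; rewrite -ler_pdivrMl // /opt; apply: lb_le_inf.
  by have [x [p tp]] := tour_exists s conn; exists (walk_length w x p), x, p.
by move=> _ [x [p [tp ->]]]; rewrite ler_pdivrMl //; apply: bnd.
Qed.

End Tours.

(** * Geometric sequences of scales *)

Section Geometric.
Variables (R : realType) (u0 : R) (E : nat).
Hypotheses (u0_gt0 : 0 < u0) (E2 : (2 <= E)%N).

Definition scale i : R := u0 * E%:R ^+ i.

Lemma scale_gt0 i : 0 < scale i.
Proof. by rewrite mulr_gt0 // exprn_gt0 // ltr0n ltnW. Qed.

Lemma scaleS i : scale i.+1 = E%:R * scale i.
Proof. by rewrite /scale exprS mulrCA. Qed.

Lemma scale_sum n : \sum_(i < n) scale i <= scale n.
Proof.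
elim: n => [|n IHn]; first by rewrite big_ord0 ltW // scale_gt0.
rewrite big_ord_recr /= scaleS; have := scale_gt0 n.
have : 2 * scale n <= E%:R * scale n by rewrite ler_pM2r ?scale_gt0 // ler_nat.
by lra.
Qed.

Lemma scale_sum_le n X : 0 <= X ->
  \sum_(i < n) (if scale i <= X then scale i else 0) <= 2 * X.
Proof.
move=> X0; elim: n => [|n IHn]; first by rewrite big_ord0; lra.
rewrite big_ord_recr /=; case: ifP => [le|_]; last by rewrite addr0.
have : \sum_(i < n) (if scale i <= X then scale i else 0) <= scale n.
  apply: le_trans (scale_sum n); apply: ler_sum => i _.
  by case: ifP => // _; rewrite ltW // scale_gt0.
by lra.
Qed.

End Geometric.

(** * Summation over the scales *)

Section Iterate.
Variables (R : realType) (G H : sgraph) (w : G -> G -> R) (delta : R) (K : nat).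
Hypothesis ew : edge_weighting w.
Hypothesis H_free : minor_free H G.
Hypothesis delta_gt0 : 0 < delta.
Hypotheses (K2 : (2 <= K)%N) (K_big : 32 <= delta * K%:R).
Variables (h : seq G) (ch : seq (G * G)).
Hypothesis cc : charged w delta h ch.
Variables (r : G) (par0 : G -> G) (rk0 : G -> nat).
Hypothesis rp0 : rooted r par0 rk0.

Definition tree_weight : R := \sum_v wpar w r par0 v.

Lemma wpar0_ge0 v : 0 <= wpar w r par0 v.
Proof. exact: wpar_ge0 ew _ _ _ rp0. Qed.

Lemma tree_weight_ge0 : 0 <= tree_weight.
Proof. by apply: sumr_ge0 => v _; apply: wpar0_ge0. Qed.

Lemma wpar_le_tree v : wpar w r par0 v <= tree_weight.
Proof.
by rewrite /tree_weight (bigD1 v) //= lerDl; apply: sumr_ge0 => x _; apply: wpar0_ge0.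
Qed.

(** If all tree edges are lighter than [e], two paths to the root form a walk to which the stretch
    applies. This bounds the scales with a nonempty class, each of which is charged one extra
    [u]. *)
Lemma charged_le_tree e : e \in ch -> w e.1 e.2 <= 2 * tree_weight.
Proof.
move=> ec; have w0 := w_ge0 ew (charged_adj cc ec); have W0 := tree_weight_ge0.
have [[x wx]|small] := pselect (exists v, w e.1 e.2 <= wpar w r par0 v).
  by have := wpar_le_tree x; lra.
have lt v : wpar w r par0 v < w e.1 e.2.
  by rewrite ltNge; apply/negP => le; apply: small; exists v.
have root v : wconn w [rel a b | w a b < w e.1 e.2] v r tree_weight.
  apply: (@wconn_le _ _ _ _ _ _ (\sum_(x | (rk0 x <= rk0 v)%N) wpar w r par0 x)).
    rewrite /tree_weight big_mkcond; apply: ler_sum => x _.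
    by case: ifP => // _; apply: wpar0_ge0.
  elim/(par_ind rp0): v => [|v vr IH].
    by apply: wconn_refl; apply: sumr_ge0 => x _; apply: wpar0_ge0.
  have [_ _ /(_ v vr) [av ltv]] := rp0.
  rewrite (bigD1 v) //=.
  have wv : wpar w r par0 v = w v (par0 v) by rewrite /wpar (negbTE vr).
  apply: wconn_trans (_ : wconn _ _ _ (par0 v) _) _.
    by rewrite wv; apply: wconn_step => //=; rewrite -wv.
  apply: wconn_le IH; rewrite big_mkcond [leRHS]big_mkcond.
  apply: ler_sum => x _; case: ifP => [lx|_].
    rewrite (leq_trans lx (ltnW ltv)) /= ifT //.
    by apply: contraTneq lx => ->; rewrite -ltnNge.
  by case: ifP => // _; apply: wpar0_ge0.
have sym a b l : wconn w [rel a b | w a b < w e.1 e.2] a b l ->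
    wconn w [rel a b | w a b < w e.1 e.2] b a l.
  by apply: (wconn_sym ew) => x y xy /=; rewrite (w_sym ew xy).
have := charged_stretch ew cc ec (wconn_trans (root e.1) (sym _ _ _ (root e.2))).
have := mulr_ge0 (ltW delta_gt0) w0; lra.
Qed.

Variables (u0 : R) (E : nat).
Hypotheses (u0_gt0 : 0 < u0) (E_big : (4 + 2 * (K + 3) <= E)%N).

Let E2 : (2 <= E)%N.
Proof. by apply: leq_trans E_big; rewrite addSn. Qed.

Local Notation u := (scale u0 E).
Local Notation ugt0 := (scale_gt0 u0_gt0 E2).

Definition weight_class z : {set G * G} := [set e in ch |
  (K%:R * z < 2 * w e.1 e.2) && (w e.1 e.2 <= K%:R * z)].

Definition heavy z := [set v | z < wpar w r par0 v].

Definition initial_edge : rel G := [rel x y | (par0 x == y) || (par0 y == x)].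

(* At scale [z], a tree edge that is not initial was charged at a smaller
   scale. *)
Definition allowed z : rel G := [rel x y | (w x y <= z) || initial_edge x y].

Lemma allowed_sym z x y : adj x y -> allowed z x y -> allowed z y x.
Proof.
move=> xy; rewrite /allowed /initial_edge /= (w_sym ew xy).
by rewrite [in (_ == x) || _]orbC.
Qed.

Lemma allowed_le z z' x y : z <= z' -> allowed z x y -> allowed z' x y.
Proof.
move=> zz /orP[le|i]; apply/orP; [left|by right]; exact: le_trans zz.
Qed.

(** Allowed edges above [z] are initial, but the current tree may direct them the other way;
    admitting both directions gives the factor 2. *)
Lemma card_longs par rk F z : 0 < z -> rooted r par rk ->
  (forall v, v != r -> allowed z v (par v)) ->
  (#|longs w r par F z| <= 2 * #|heavy z|)%N.
Proof.
move=> z0 rp al; have [_ _ prk] := rp; have [pr0 _ prk0] := rp0.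
pose A := [set (v, par0 v) | v in heavy z] :|: [set (par0 v, v) | v in heavy z].
apply: (@leq_trans #|A|); last first.
  rewrite mul2n -addnn; apply: leq_trans (leq_card_setU _ _) _.
  by apply: leq_add; apply: leq_imset_card.
have inj : injective (fun v => (v, par v)) by move=> x y [].
rewrite -(card_imset _ inj); apply/subset_leq_card/subsetP => _ /imsetP[v + ->].
rewrite inE => /andP[_ zv].
have vr : v != r.
  by apply: contraTneq zv => ->; rewrite /wpar eqxx -leNgt ltW.
have ad : adj v (par v) by have [] := prk v vr.
move: zv; rewrite /wpar (negbTE vr) => zv.
have := al v vr; rewrite /allowed /= leNgt zv /= => /orP[]/eqP e.
  apply/setUP; left; apply/imsetP; exists v; rewrite ?e // inE.
  by rewrite /wpar (negbTE vr) e.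
have pvr : par v != r by apply: contraNneq vr => e2; rewrite -e e2 pr0.
apply/setUP; right; apply/imsetP; exists (par v); rewrite ?e // inE.
by rewrite /wpar (negbTE pvr) e (w_sym ew) // adj_sym.
Qed.

(** The core weights telescope, and the factor 2 undoes the halving in [level_improves]. A scale
    with an empty class leaves the tree alone, so it is not charged the 1 in [#|longs|.+1]. *)
Lemma levels n : exists par rk F, [/\ tree_state w r par rk F (u n),
    forall v, v != r -> allowed (u n) v (par v)
  & \sum_(i < n) u i * #|weight_class (u i)|%:R <= (level_const H K)%:R *
      (2 * (tree_weight - \sum_(v in F) wpar w r par v) +
       \sum_(i < n) u i * (2 * #|heavy (u i)| + (weight_class (u i) != set0))%:R)].
Proof.
elim: n => [|n [par [rk [F [st al le]]]]].
  exists par0, rk0, [set: G]; split.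
  - split=> // v; exists 0%N; rewrite ?inE //=; exact: ltW (ugt0 0%N).
  - by move=> v vr; rewrite /allowed /initial_edge /= eqxx orbT.
  rewrite !big_ord0 addr0 (eq_bigl predT); last by move=> v; rewrite inE.
  by rewrite subrr !mulr0.
have u_le : u n <= u n.+1.
  by rewrite scaleS ler_peMl ?(ltW (ugt0 n)) // ler1n ltnW.
have [rp rF upF cov] := st.
have [e0|B0] := eqVneq (weight_class (u n)) set0.
  exists par, rk, F; split.
  - split=> // v; have [m mF pm] := cov v; exists m => //; exact: le_trans u_le.
  - by move=> v /al; apply: allowed_le.
  rewrite !big_ord_recr /= e0 cards0 mulr0 addr0 eqxx addn0.
  apply: le_trans le _; rewrite ler_wpM2l ?ler0n // lerD2l lerDl.
  by rewrite mulr_ge0 ?ler0n // ltW // ugt0.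
have al' v : v != r -> allowed (u n.+1) v (par v).
  by move=> /al; apply: allowed_le.
have chB e : e \in weight_class (u n) -> e \in ch by rewrite inE => /andP[].
have wB e : e \in weight_class (u n) ->
    K%:R * u n < 2 * w e.1 e.2 /\ w e.1 e.2 <= K%:R * u n.
  by rewrite inE => /and3P[].
have KR : 2 <= K%:R :> R by rewrite (ler_nat _ 2).
have ltB e : e \in weight_class (u n) -> u n < w e.1 e.2.
  move=> /wB[lt _]; have : 2 * u n <= K%:R * u n by rewrite ler_pM2r // ugt0.
  by lra.
have dB e : e \in weight_class (u n) -> 16 * u n <= delta * w e.1 e.2.
  move=> /wB[lt _]; have : 32 * u n <= delta * K%:R * u n by rewrite ler_pM2r // ugt0.
  have : delta * (K%:R * u n) < delta * (2 * w e.1 e.2) by rewrite ltr_pM2l.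
  by lra.
have [||||m [cB [par' [rk' [F' [st' le' al2]]]]]] :=
  @level_improves R G w r par rk F (u n) ew rp rF upF (ugt0 n) cov
    (allowed (u n.+1)) (@allowed_sym _) al' H delta K (weight_class (u n))
    H_free delta_gt0 _ _ wB.
- by apply: le_trans K_big; rewrite ler_nat.
- move=> e eB; split; first exact: charged_adj cc (chB e eB).
  rewrite /allowed /=; apply/orP; left; have [_ le1] := wB e eB.
  apply: le_trans le1 _; rewrite scaleS ler_pM2r ?ugt0 // ler_nat.
  by apply: leq_trans E_big; lia.
- move=> e eB s wc; apply: (charged_stretch ew cc (chB e eB)).
  apply: wconn_sub wc => a b _; rewrite /light /= => le1.
  exact: le_lt_trans (ltB e eB).
- move=> e f eB fB ef.
  exact: (charged_apart ew cc (chB e eB) (chB f fB) ef (dB e eB) (dB f fB)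
    (ltB e eB) (ltB f fB)).
exists par', rk', F'; split=> //.
  case: st' => a b c d; split=> // v; have [j jF pj] := d v; exists j => //.
  by apply: le_trans pj _; rewrite scaleS ler_pM2r ?ugt0 // ler_nat.
rewrite !big_ord_recr /= B0 /=.
have cl : (#|longs w r par F (u n)| <= 2 * #|heavy (u n)|)%N.
  exact: card_longs (ugt0 n) rp al.
set C := (level_const H K)%:R in le *; set X := \sum_(i < n) _ * (_)%:R in le *.
have C0 : 0 <= C by rewrite ler0n.
have bB : #|weight_class (u n)|%:R <= C * (m + (2 * #|heavy (u n)|).+1)%:R.
  by rewrite -natrM ler_nat; apply: leq_trans cB _; rewrite leq_mul2l leq_add2l ltnS cl orbT.
have : u n * #|weight_class (u n)|%:R <=
    C * (2 * (\sum_(v in F) wpar w r par v - \sum_(v in F') wpar w r par' v) +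
         u n * (2 * #|heavy (u n)| + 1)%:R).
  apply: (@le_trans _ _ (u n * (C * (m + (2 * #|heavy (u n)|).+1)%:R))).
    by rewrite ler_pM2l ?ugt0.
  rewrite mulrCA ler_wpM2l // -addn1 natrD mulrDr lerD2r.
  have e2 : m%:R * u n / 2 * 2 = u n * m%:R :> R by field.
  by move: le' e2; lra.
move=> hn; apply: le_trans (lerD le hn) _; rewrite -mulrDr ler_wpM2l //.
lra.
Qed.

Lemma sum_heavy n : \sum_(i < n) u i * #|heavy (u i)|%:R <= 2 * tree_weight.
Proof.
have -> : \sum_(i < n) u i * #|heavy (u i)|%:R =
    \sum_(i < n) \sum_v (if u i < wpar w r par0 v then u i else 0).
  apply: eq_bigr => i _; rewrite -big_mkcond /= mulr_natr -sumr_const.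
  by apply: eq_bigl => v; rewrite inE.
rewrite exchange_big mulr_sumr; apply: ler_sum => v _.
apply: le_trans (scale_sum_le u0_gt0 E2 n (wpar0_ge0 v)).
apply: ler_sum => i _; case: ltP => [/ltW -> //|_].
by case: ifP => // _; apply: ltW (ugt0 i).
Qed.

(** Here 10 is 2 for the initial core, 4 for the heavy edges and 4 for the nonempty classes; [K]
    comes from weights of up to [K * u]. *)
Lemma sum_classes n : \sum_(i < n) \sum_(e in weight_class (u i)) w e.1 e.2 <=
  (10 * K * level_const H K)%:R * tree_weight.
Proof.
have [par [rk [F [[rp _ _ _] _ le]]]] := levels n.
have F0 : 0 <= \sum_(v in F) wpar w r par v.
  by apply: sumr_ge0 => v _; apply: wpar_ge0 ew _ _ _ rp.
have W0 := tree_weight_ge0; have KR : 2 <= K%:R :> R by rewrite (ler_nat _ 2).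
have root : \sum_(i < n) u i * (weight_class (u i) != set0)%:R <=
    2 * (2 * tree_weight).
  apply: le_trans (scale_sum_le u0_gt0 E2 n (_ : 0 <= 2 * tree_weight)); last by lra.
  apply: ler_sum => i _; have [->|[e eB]] := set_0Vmem (weight_class (u i)).
    rewrite eqxx mulr0; case: ifP => // _; exact: ltW (ugt0 i).
  rewrite ifT; first by rewrite ler_piMr ?(ltW (ugt0 i)) // lern1 leq_b1.
  move: eB; rewrite inE => /and3P[/charged_le_tree le1 lt _].
  have : 2 * u i <= K%:R * u i by rewrite ler_pM2r // ugt0.
  by lra.
have heavy_le := sum_heavy n.
apply: (@le_trans _ _ (K%:R * \sum_(i < n) u i * #|weight_class (u i)|%:R)).
  rewrite mulr_sumr; apply: ler_sum => i _.
  rewrite mulrA mulr_natr -sumr_const; apply: ler_sum => e.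
  by rewrite inE => /and3P[].
have -> : (10 * K * level_const H K)%:R * tree_weight =
    K%:R * ((level_const H K)%:R * (10%:R * tree_weight)).
  by rewrite !natrM; ring.
rewrite ler_wpM2l ?ler0n //; apply: le_trans le _; rewrite ler_wpM2l ?ler0n //.
have -> : \sum_(i < n) u i * (2 * #|heavy (u i)| + (weight_class (u i) != set0))%:R
  = 2 * (\sum_(i < n) u i * #|heavy (u i)|%:R) +
    \sum_(i < n) u i * (weight_class (u i) != set0)%:R.
  rewrite mulr_sumr -big_split /=; apply: eq_bigr => i _.
  by rewrite natrD natrM; ring.
by lra.
Qed.

End Iterate.

(** * From one sequence of scales to all weights *)

Section Total.
Variables (R : realType) (G H : sgraph) (w : G -> G -> R) (delta : R) (K : nat).
Hypothesis ew : edge_weighting w.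
Hypothesis H_free : minor_free H G.
Hypothesis delta_gt0 : 0 < delta.
Hypotheses (K2 : (2 <= K)%N) (K_big : 32 <= delta * K%:R).

(** This lets the scales start below all positive weights; edges of weight zero lie in no class and
    add nothing. *)
Lemma pos_lower_bound (s : seq R) :
  exists2 b, 0 < b & {in s, forall x, 0 < x -> b <= x}.
Proof.
elim: s => [|x s [b b0 sb]]; first by exists 1.
have [x0|x0] := ltP 0 x; last first.
  exists b => // y; rewrite inE => /predU1P[->|/sb //]; lra.
exists (Num.min b x); first by rewrite lt_min b0.
move=> y; rewrite inE ge_min => /predU1P[->|/sb h /h ->//].
by rewrite lexx orbT.
Qed.

Lemma sum_ord_mul (a n : nat) (f : nat -> R) :
  \sum_(z < a * n) f z = \sum_(j < a) \sum_(i < n) f (j + a * i)%N.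
Proof.
elim: n => [|n IHn].
  by rewrite muln0 big_ord0 big1 // => j _; rewrite big_ord0.
rewrite mulnSr big_split_ord /= IHn -big_split /=; apply: eq_bigr => j _.
by rewrite big_ord_recr /= addnC.
Qed.

(** The dyadic classes are split by their index modulo [width] into sequences of ratio [2 ^ width],
    which exceeds the growth of the covering radius because [n < 2 ^ n]. *)
Let width := (4 + 2 * (K + 3))%N.

Definition spanner_const := (width * (10 * K * level_const H K))%N.

Lemma charged_weight h ch r par0 rk0 :
  charged w delta h ch -> rooted r par0 rk0 ->
  \sum_(e <- ch) w e.1 e.2 <= spanner_const%:R * \sum_v wpar w r par0 v.
Proof.
move=> cc rp0; set W := \sum_v _.
have w0 e : e \in ch -> 0 <= w e.1 e.2.
  by move=> /(charged_adj cc) /(w_ge0 ew).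
have [b b0 chb] := pos_lower_bound [seq w e.1 e.2 | e <- ch].
have KR : 2 <= K%:R :> R by rewrite (ler_nat _ 2).
pose u0 := b / K%:R; have Ku : K%:R * u0 = b by rewrite mulrC divfK //; lra.
have u00 : 0 < u0 by rewrite divr_gt0 //; lra.
pose cls z := weight_class w K ch (scale u0 2 z).
have Kscale z : K%:R * scale u0 2 z = b * 2 ^+ z by rewrite mulrA Ku.
have [N chN] : exists N, {in ch, forall e, w e.1 e.2 <= b * 2 ^+ N}.
  elim: {chb cc cls} ch w0 => [|e s IHs] w0; first by exists 0%N.
  have [|N sN] := IHs; first by move=> f fs; apply: w0; rewrite inE fs orbT.
  have e0 : 0 <= w e.1 e.2 / b.
    by rewrite divr_ge0 ?(ltW b0) // w0 // inE eqxx.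
  pose M := Num.bound (w e.1 e.2 / b); exists (maxn N M) => f.
  have b2 m n : (m <= n)%N -> b * 2 ^+ m <= b * 2 ^+ n.
    by move=> mn; rewrite ler_pM2l // ler_weXn2l // ler1n.
  rewrite inE => /predU1P[->|/sN le]; last first.
    by apply: le_trans le _; apply: b2; apply: leq_maxl.
  apply: le_trans (b2 _ _ (leq_maxr N M)); rewrite mulrC -ler_pdivrMr //.
  apply: le_trans (ltW (archi_boundP e0)) _; rewrite -natrX ler_nat.
  exact: ltnW (ltn_expl _ _).
have cover e : e \in ch -> 0 < w e.1 e.2 ->
    exists2 z, (z < N.+1)%N & e \in cls z.
  move=> ec e0; have ex : exists z, w e.1 e.2 <= b * 2 ^+ z.
    by exists N; apply: chN.
  case: (ex_minnP ex) => z wz zmin; exists z; first by rewrite ltnS zmin // chN.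
  rewrite inE ec Kscale wz andbT /=; case: z wz zmin => [|z] _ zmin.
    have := chb (w e.1 e.2) (map_f _ ec) e0; rewrite expr0; lra.
  rewrite exprS mulrCA ltr_pM2l // ltNge; apply/negP => /zmin.
  by rewrite ltnn.
apply: (@le_trans _ _ (\sum_(z < width * N.+1) \sum_(e in cls z) w e.1 e.2)).
  have -> : \sum_(z < width * N.+1) \sum_(e in cls z) w e.1 e.2 =
      \sum_(e in ch) \sum_(z < width * N.+1 | e \in cls z) w e.1 e.2.
    rewrite (exchange_big_dep (mem ch)) //= => z e _.
    by rewrite inE => /andP[].
  rewrite big_uniq ?(charged_uniq cc) //=; apply: ler_sum => e ec.
  have pos : 0 <= \sum_(z < width * N.+1 | e \in cls z) w e.1 e.2.
    by apply: sumr_ge0 => z _; apply: w0.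
  have := w0 e ec; rewrite le_eqVlt => /predU1P[e0|/(cover e ec)[z zN ez]].
    by rewrite -{1}e0.
  have zZ : (z < width * N.+1)%N.
    by apply: leq_trans zN _; rewrite leq_pmull // /width addSn.
  rewrite (bigD1 (Ordinal zZ)) //= lerDl; apply: sumr_ge0 => z' _.
  exact: w0.
rewrite (sum_ord_mul _ _ (fun z => \sum_(e in cls z) w e.1 e.2)).
apply: (@le_trans _ _ (\sum_(j < width) (10 * K * level_const H K)%:R * W)).
  apply: ler_sum => j _.
  have uj : 0 < u0 * 2 ^+ j by rewrite mulr_gt0 // exprn_gt0.
  have Ew : (4 + 2 * (K + 3) <= 2 ^ width)%N by apply: ltnW (ltn_expl _ _).
  apply: le_trans (sum_classes ew H_free delta_gt0 K2 K_big cc rp0 uj Ew N.+1).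
  apply: ler_sum => i _; rewrite /cls.
  suff -> : scale u0 2 (j + width * i) = scale (u0 * 2 ^+ j) (2 ^ width) i by [].
  by rewrite /scale exprD exprM natrX mulrA.
by rewrite sumr_const card_ord -[leLHS]mulr_natl mulrA -natrM.
Qed.

End Total.

Theorem theorem1 (R : realType) (H : sgraph) (delta : R) :
  0 < delta ->
  exists c : R, competitive (blocking delta) (minor_free H) c.
Proof.
(* An edge of a class weighs more than [K * u / 2], and [charged_apart] asks for
   [16 * u <= delta * w], hence 32. The [.+2] gives [2 <= K], so that these edges are longer than
   [u]. *)
move=> delta_gt0; pose K := (Num.bound (32 / delta)).+2.
have K_big : 32 <= delta * K%:R.
  rewrite -ler_pdivrMl // mulrC; apply: le_trans (ltW (archi_boundP _)) _.
    by rewrite divr_ge0 // ltW.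
  by rewrite ler_nat /K ltnW.
pose c0 : R := (4 + 2 * delta) * (spanner_const H K)%:R.
have c0_ge0 : 0 <= c0 by rewrite mulr_ge0 // addr_ge0 // mulr_ge0 // ltW.
(* The summand 1 makes the factor positive, as [opt_ge] requires. *)
exists (c0 + 1) => G w s t conn ew H_free [h call].
have [|ch [cc _ _ wt]] := call_charged ew delta_gt0 _ call.
  by rewrite inE.
apply: (opt_ge s conn); first by rewrite ltr_wpDl.
move=> x p tp; have [par [rk [rp W]]] := tour_tree ew tp.
have W0 : 0 <= \sum_v wpar w x par v.
  by apply: sumr_ge0 => v _; apply: wpar_ge0 ew _ _ _ rp.
apply: le_trans wt _; apply: (@le_trans _ _ (c0 * \sum_v wpar w x par v)).
  rewrite /c0 -mulrA ler_pM2l; last by lra.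
  exact: charged_weight cc rp.
apply: (@le_trans _ _ ((c0 + 1) * \sum_v wpar w x par v)).
  by rewrite ler_wpM2r // lerDl.
by rewrite ler_wpM2l // addr_ge0.
Qed.
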